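(* Let $(S,\theta)$ be an ID-simple ring with field of constants $C=C_S$ and let $M$ be an ID-module over $S$. If $C$ is algebraically closed, then there exists a Picard-Vessiot ring for $M$, and it is unique up to ID-isomorphism (i.e. any two Picard-Vessiot rings for $M$ are isomorphic as ID-ring extensions of $S$).
   Context: All rings are commutative with unit and nonzero; rings are not assumed Noetherian. An iterative derivation on a ring $R$ is a ring homomorphism $\theta:R\to R[[T]]$, written $\theta(r)=\sum_{i\ge 0}\theta^{(i)}(r)T^i$, with $\theta^{(0)}=\mathrm{id}_R$ and $\theta^{(i)}\circ\theta^{(j)}=\binom{i+j}{i}\theta^{(i+j)}$ for all $i,j\ge 0$; then $(R,\theta)$ is an ID-ring. Its ring of constants is $C_R=\{r\in R\mid \theta(r)=r\}$. An ideal $I$ of $R$ is an ID-ideal if $\theta(I)\subseteq I[[T]]$; $R$ is ID-simple if its only ID-ideals are $\{0\}$ and $R$ (the constants of an ID-simple ring form a field). A homomorphism of ID-rings is a ring homomorphism commuting with all $\theta^{(n)}$. An ID-module $(M,\theta_M)$ over an ID-ring $R$ is a finitely generated $R$-module $M$ with an additive map $\theta_M:M\to M[[T]]$, $\theta_M(m)=\sum_i\theta_M^{(i)}(m)T^i$, such that $\theta_M(rm)=\theta(r)\theta_M(m)$, $\theta_M^{(0)}=\mathrm{id}_M$, $\theta_M^{(i)}\circ\theta_M^{(j)}=\binom{i+j}{i}\theta_M^{(i+j)}$. An ID-module is trivial if it has a finite $R$-basis consisting of constant elements ($\theta_M(m)=m$). Tensor products carry $\theta^{(k)}(a\otimes b)=\sum_{i+j=k}\theta^{(i)}(a)\otimes\theta^{(j)}(b)$.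 Let $M$ be an ID-module over the ID-simple ring $S$ with constants $C$. A solution ring for $M$ is an ID-simple ring $R$ with a homomorphism of ID-rings $f:S\to R$ (automatically injective, so $R$ is viewed as an extension of $S$) such that $C_R=f(C)$ and $R\otimes_S M$ is a trivial ID-module over $R$. A Picard-Vessiot ring for $M$ is a solution ring $(R,f)$ that is minimal: for every solution ring $(\tilde R,\tilde f)$ for $M$, every ID-homomorphism $g:\tilde R\to R$ with $g\circ\tilde f=f$ is an isomorphism. *)

(* Defs.v *)
From HB Require Import structures.
From mathcomp Require Import all_boot all_order all_algebra.
From mathcomp Require Import zify.
From mathcomp Require Import boolp classical_sets.

Set Implicit Arguments.
Unset Strict Implicit.
Unset Printing Implicit Defensive.

Import GRing.Theory.
Local Open Scope ring_scope.
Local Open Scope quotient_scope.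

(* [theta k r] is the coefficient of T^k in theta(r).  The fields [thetaD],   *)
(* [theta1] and [thetaM] say, coefficient by coefficient, that                *)
(* theta : R -> R[[T]] is a homomorphism of unital rings.                     *)
HB.mixin Record isIDRing R of GRing.ComNzRing R := {
  theta : nat -> R -> R;
  thetaD : forall k x y, theta k (x + y) = theta k x + theta k y;
  theta1 : forall k, theta k 1 = if k is 0%N then 1 else 0;
  thetaM : forall k x y,
    theta k (x * y) = \sum_(i < k.+1) theta i x * theta (k - i)%N y;
  theta0 : forall x, theta 0%N x = x;
  thetaC : forall i j x, theta i (theta j x) = theta (i + j)%N x *+ 'C(i + j, i)
}.

#[short(type="idRingType")]
HB.structure Definition IDRing := {R of isIDRing R & GRing.ComNzRing R}.

HB.mixin Record isIDMorphism (S R : idRingType) (f : S -> R) := {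
  idmorphE : forall k s, f (theta k s) = theta k (f s)
}.

HB.structure Definition IDMorphism (S R : idRingType) :=
  {f of @isIDMorphism S R f & @GRing.RMorphism S R f}.

Notation "{ 'idmorphism' S -> R }" := (IDMorphism.type S R)
  (at level 0, S at level 98, R at level 99,
   format "{ 'idmorphism'  S  ->  R }") : type_scope.

(* [mtheta k m] is the coefficient of T^k in theta_M(m). *)
HB.mixin Record isIDModule (R : idRingType) M of GRing.Lmodule R M := {
  mtheta : nat -> M -> M;
  mthetaD : forall k m n, mtheta k (m + n) = mtheta k m + mtheta k n;
  mthetaZ : forall k r m,
    mtheta k (r *: m) = \sum_(i < k.+1) theta i r *: mtheta (k - i)%N m;
  mtheta0 : forall m, mtheta 0%N m = m;
  mthetaC : forall i j m,
    mtheta i (mtheta j m) = mtheta (i + j)%N m *+ 'C(i + j, i);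
  mfingen : exists (n : nat) (g : 'I_n -> M),
    forall m, exists c : 'I_n -> R, m = \sum_i c i *: g i
}.

#[short(type="idModType")]
HB.structure Definition IDModule (R : idRingType) :=
  {M of isIDModule R M & GRing.Lmodule R M}.

Section Constants.
Variable R : idRingType.

Definition constants : {pred R} :=
  fun r => `[< forall k, theta k r = if k is 0%N then r else 0 >].

Lemma theta_is_zmod_morphism k : zmod_morphism (@theta R k).
Proof.
move=> x y; have E := thetaD k (x - y) y.
by rewrite subrK in E; rewrite E addrK.
Qed.

HB.instance Definition _ k :=
  GRing.isZmodMorphism.Build R R (@theta R k) (@theta_is_zmod_morphism k).

Lemma constants_subring_closed : subring_closed constants.
Proof.
split.
- by apply/asboolP => k; rewrite theta1.
- move=> x y /asboolP hx /asboolP hy; apply/asboolP => k.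
  by rewrite theta_is_zmod_morphism hx hy; case: k => // k; rewrite subr0.
- move=> x y /asboolP hx /asboolP hy; apply/asboolP => k.
  rewrite thetaM; case: k => [|k]; first by rewrite big_ord1 !theta0.
  rewrite big1 // => i _; rewrite hx hy; case: i => -[|i] hi /=.
    by rewrite mulr0.
  by rewrite mul0r.
Qed.

HB.instance Definition _ :=
  GRing.isSubringClosed.Build R constants constants_subring_closed.

Record const_ring := ConstRing {
  const_val : R;
  const_valP : const_val \in constants
}.

HB.instance Definition _ := [isSub for const_val].
HB.instance Definition _ := [Choice of const_ring by <:].
HB.instance Definition _ := [SubChoice_isSubComNzRing of const_ring by <:].

(* Improper ideals included, unlike [idealr_closed]. *)
Definition is_ideal (I : set R) : Prop :=
  [/\ I 0, (forall x y, I x -> I y -> I (x + y))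
    & (forall a x, I x -> I (a * x))].

Definition is_id_ideal (I : set R) : Prop :=
  is_ideal I /\ (forall k x, I x -> I (theta k x)).

Definition id_simple : Prop :=
  forall I : set R, is_id_ideal I -> I = [set 0]%classic \/ I = setT.

End Constants.

Arguments constants R _ : clear implicits.

Section TrivialModule.
Variables (R : idRingType) (M : idModType R).

Definition mconstant (m : M) : Prop :=
  forall k, mtheta k m = if k is 0%N then m else 0.

Definition is_basis (n : nat) (e : 'I_n -> M) : Prop :=
  (forall m, exists c : 'I_n -> R, m = \sum_i c i *: e i) /\
  (forall c : 'I_n -> R, \sum_i c i *: e i = 0 -> forall i, c i = 0).

Definition trivial_idmod : Prop :=
  exists (n : nat) (e : 'I_n -> M), is_basis e /\ forall i, mconstant (e i).

End TrivialModule.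

Lemma big_triple (V : nmodType) (F : nat -> nat -> nat -> V) k :
  \sum_(l < k.+1) \sum_(i < l.+1) F i (l - i)%N (k - l)%N =
  \sum_(i < k.+1) \sum_(j < (k - i).+1) F i j (k - i - j)%N.
Proof.
have E (l : 'I_k.+1) : \sum_(i < l.+1) F i (l - i)%N (k - l)%N =
    \sum_(i < k.+1 | (i <= l)%N) F i (l - i)%N (k - l)%N.
  rewrite (big_ord_widen k.+1 (fun i => F i (l - i)%N (k - l)%N)) //.
rewrite (eq_bigr _ (fun l _ => E l)) (exchange_big_dep predT) //=.
apply: eq_bigr => i _.
rewrite -[LHS](big_mkord (fun l => i <= l)%N (fun l => F i (l - i)%N (k - l)%N)).
rewrite -[RHS](big_mkord predT (fun j => F i j (k - i - j)%N)) -subSn; last first.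
  by rewrite -ltnS.
rewrite (big_cat_nat (n := i)) //=; last by rewrite ltnW.
rewrite big_nat_cond big1 ?add0r; last first.
  by move=> l /andP[/andP[_ h1] h2]; move: h1; rewrite ltnNge h2.
rewrite big_nat_cond (eq_bigl (fun l => (i <= l < k.+1)%N)); last first.
  by move=> l /=; case: (i <= l)%N; rewrite ?andbT.
rewrite -big_nat -{1}[nat_of_ord i]add0n big_addn.
by apply: eq_bigr => j _; rewrite addnK addnC subnDA.
Qed.

(* R (x)_S M, with R an S-module along f, by generators and relations: finite *)
(* formal sums of pairs (a, m), listed as sequences, modulo the least         *)
(* congruence making (a, m) |-> a (x) m biadditive and S-balanced.            *)
Section Tensor.
Variables (S R : idRingType) (f : {idmorphism S -> R}) (M : idModType S).

Inductive tens_rel : seq (R * M) -> seq (R * M) -> Prop :=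
| tens_refl u : tens_rel u u
| tens_sym u v : tens_rel u v -> tens_rel v u
| tens_trans u v w : tens_rel u v -> tens_rel v w -> tens_rel u w
| tens_cat u u' v v' :
    tens_rel u u' -> tens_rel v v' -> tens_rel (u ++ v) (u' ++ v')
| tens_comm u v : tens_rel (u ++ v) (v ++ u)
| tens_0l m : tens_rel [:: (0, m)] [::]
| tens_Dl a b m : tens_rel [:: (a + b, m)] [:: (a, m); (b, m)]
| tens_Dr a m n : tens_rel [:: (a, m + n)] [:: (a, m); (a, n)]
| tens_bal a s m : tens_rel [:: (a * f s, m)] [:: (a, s *: m)].

Definition tens_relb : rel (seq (R * M)) := fun u v => `[< tens_rel u v >].

Lemma tens_relb_equiv : equiv_class_of tens_relb.
Proof.
split.
- by move=> u; apply/asboolP/tens_refl.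
- by move=> u v; apply/asboolP/asboolP => /tens_sym.
- move=> v u w /asboolP h1 /asboolP h2; apply/asboolP; exact: tens_trans h1 h2.
Qed.

Canonical tens_equiv := EquivRelPack tens_relb_equiv.

Definition idtensor := {eq_quot tens_equiv}.

HB.instance Definition _ := Choice.on idtensor.
HB.instance Definition _ := Quotient.on idtensor.
HB.instance Definition _ := EqQuotient.on idtensor.

Lemma tens_piP u v : tens_rel u v <-> \pi_idtensor u = \pi_idtensor v.
Proof. by split=> [h|/eqmodP/asboolP //]; apply/eqmodP/asboolP. Qed.

Lemma tens_quotW (P : idtensor -> Prop) :
  (forall u, P (\pi_idtensor u)) -> forall t, P t.
Proof. by move=> h t; rewrite -[t]reprK. Qed.

Lemma tens_reprP u : tens_rel (repr (\pi_idtensor u)) u.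
Proof. by apply/tens_piP; rewrite reprK. Qed.

Definition tens_pure (a : R) (m : M) : idtensor := \pi_idtensor [:: (a, m)].
Definition tens_zero : idtensor := \pi_idtensor [::].
Definition tens_add (t u : idtensor) : idtensor :=
  \pi_idtensor (repr t ++ repr u).
Definition tens_opp (t : idtensor) : idtensor :=
  \pi_idtensor [seq (- p.1, p.2) | p <- repr t].

Lemma tens_add_pi u v :
  tens_add (\pi_idtensor u) (\pi_idtensor v) = \pi_idtensor (u ++ v).
Proof. by apply/tens_piP/tens_cat; apply: tens_reprP. Qed.

Lemma tens_opp_rel u v : tens_rel u v ->
  tens_rel [seq (- p.1, p.2) | p <- u] [seq (- p.1, p.2) | p <- v].
Proof.
elim=> {u v} [u|u v _|u v w _ h1 _ h2|u u' v v' _ h1 _ h2|u v|m|a b m|a m n|a s m].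
- exact: tens_refl.
- exact: tens_sym.
- exact: tens_trans h1 h2.
- by rewrite !map_cat; apply: tens_cat.
- by rewrite !map_cat; apply: tens_comm.
- by rewrite /= oppr0; apply: tens_0l.
- by rewrite /= opprD; apply: tens_Dl.
- exact: tens_Dr.
- by rewrite /= -mulNr; apply: tens_bal.
Qed.

Lemma tens_opp_pi u :
  tens_opp (\pi_idtensor u) = \pi_idtensor [seq (- p.1, p.2) | p <- u].
Proof. by apply/tens_piP/tens_opp_rel/tens_reprP. Qed.

Lemma tens_addA : associative tens_add.
Proof.
move=> t1 t2 t3.
elim/tens_quotW: t1 => u; elim/tens_quotW: t2 => v; elim/tens_quotW: t3 => w.
by rewrite !tens_add_pi catA.
Qed.

Lemma tens_addC : commutative tens_add.
Proof.
move=> t1 t2; elim/tens_quotW: t1 => u; elim/tens_quotW: t2 => v; rewrite !tens_add_pi.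
exact/tens_piP/tens_comm.
Qed.

Lemma tens_add0 : left_id tens_zero tens_add.
Proof. by move=> t; elim/tens_quotW: t => u; rewrite tens_add_pi. Qed.

Lemma tens_addN : left_inverse tens_zero tens_opp tens_add.
Proof.
move=> t; elim/tens_quotW: t => u; rewrite tens_opp_pi tens_add_pi; apply/tens_piP.
elim: u => [|[a m] u IH] /=; first exact: tens_refl.
set w := [seq _ | p <- u] in IH *.
have h : tens_rel (w ++ (a, m) :: u) ((a, m) :: w ++ u).
  rewrite -(cat1s _ u) catA -[_ :: w ++ u]/(([:: (a, m)] ++ w) ++ u).
  by apply: tens_cat; [apply: tens_comm | apply: tens_refl].
apply: (@tens_trans _ ([:: (- a, m); (a, m)] ++ (w ++ u))).
  by apply: (@tens_cat [:: _] [:: _] _ ((a, m) :: _)); [apply: tens_refl | ].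
rewrite -[X in tens_rel _ X]cat0s; apply: tens_cat => //.
apply: tens_trans (tens_sym (tens_Dl _ _ _)) _; rewrite addNr.
exact: tens_0l.
Qed.

HB.instance Definition _ :=
  GRing.isZmodule.Build idtensor tens_addA tens_addC tens_add0 tens_addN.

Lemma tens_pureDl a b m : tens_pure (a + b) m = tens_pure a m + tens_pure b m.
Proof. by rewrite [RHS]tens_add_pi; apply/tens_piP/tens_Dl. Qed.

Lemma tens_pureDr a m n : tens_pure a (m + n) = tens_pure a m + tens_pure a n.
Proof. by rewrite [RHS]tens_add_pi; apply/tens_piP/tens_Dr. Qed.

Lemma tens_pureZ a s m : tens_pure a (s *: m) = tens_pure (a * f s) m.
Proof. exact/esym/tens_piP/tens_bal. Qed.

Lemma tens_pure0l m : tens_pure 0 m = 0.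
Proof. exact/tens_piP/tens_0l. Qed.

Lemma tens_pure0r a : tens_pure a 0 = 0.
Proof. by rewrite -[0](scale0r 0) tens_pureZ rmorph0 mulr0 tens_pure0l. Qed.

Lemma tens_pure_suml I (r : seq I) (P : pred I) (F : I -> R) m :
  tens_pure (\sum_(i <- r | P i) F i) m = \sum_(i <- r | P i) tens_pure (F i) m.
Proof.
by apply: (big_morph (fun a => tens_pure a m)) => [a b|];
  rewrite ?tens_pureDl ?tens_pure0l.
Qed.

Lemma tens_pure_sumr I (r : seq I) (P : pred I) (F : I -> M) a :
  tens_pure a (\sum_(i <- r | P i) F i) = \sum_(i <- r | P i) tens_pure a (F i).
Proof.
by apply: (big_morph (tens_pure a)) => [m n|]; rewrite ?tens_pureDr ?tens_pure0r.
Qed.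

Lemma tens_pureMnl a m k : tens_pure (a *+ k) m = tens_pure a m *+ k.
Proof. by elim: k => [|k IH]; rewrite ?mulr0n ?tens_pure0l // !mulrS tens_pureDl IH. Qed.

Lemma tens_pureMnr a m k : tens_pure a (m *+ k) = tens_pure a m *+ k.
Proof. by elim: k => [|k IH]; rewrite ?mulr0n ?tens_pure0r // !mulrS tens_pureDr IH. Qed.

Lemma tens_pi_sum u : \pi_idtensor u = \sum_(p <- u) tens_pure p.1 p.2.
Proof.
elim: u => [|[a m] u IH]; first by rewrite big_nil.
by rewrite big_cons -IH [RHS]tens_add_pi.
Qed.

Lemma tens_ind (P : idtensor -> Prop) :
  P 0 -> (forall t u, P t -> P u -> P (t + u)) ->
  (forall a m, P (tens_pure a m)) -> forall t, P t.
Proof.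
move=> P0 PD Pp t; elim/tens_quotW: t => u; rewrite tens_pi_sum.
by elim/big_ind: _ => // p _; apply: Pp.
Qed.

Section Lift.
Variables (N : zmodType) (h : R -> M -> N).

Definition tens_lift (t : idtensor) : N := \sum_(p <- repr t) h p.1 p.2.

Hypothesis hDl : forall a b m, h (a + b) m = h a m + h b m.
Hypothesis hDr : forall a m n, h a (m + n) = h a m + h a n.
Hypothesis hZ : forall a s m, h (a * f s) m = h a (s *: m).

Lemma tens_lift_rel u v : tens_rel u v ->
  \sum_(p <- u) h p.1 p.2 = \sum_(p <- v) h p.1 p.2.
Proof.
elim=> {u v} //.
- by move=> u v w _ -> _ ->.
- by move=> u u' v v' _ h1 _ h2; rewrite !big_cat /= h1 h2.
- by move=> u v; rewrite !big_cat /= addrC.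
- move=> m; rewrite big_seq1 big_nil /=; apply: (addrI (h 0 m)).
  by rewrite -hDl !addr0.
- by move=> a b m; rewrite !big_cons !big_nil /= hDl !addr0.
- by move=> a m n; rewrite !big_cons !big_nil /= hDr !addr0.
- by move=> a s m; rewrite !big_seq1 /= hZ.
Qed.

Lemma tens_lift_pure a m : tens_lift (tens_pure a m) = h a m.
Proof. by rewrite /tens_lift (tens_lift_rel (tens_reprP _)) big_seq1. Qed.

Lemma tens_liftD t u : tens_lift (t + u) = tens_lift t + tens_lift u.
Proof.
elim/tens_quotW: t => u1; elim/tens_quotW: u => u2; rewrite [_ + _]tens_add_pi.
by rewrite /tens_lift !(tens_lift_rel (tens_reprP _)) big_cat.
Qed.

Lemma tens_lift0 : tens_lift 0 = 0.
Proof. by apply: (addrI (tens_lift 0)); rewrite -tens_liftD !addr0. Qed.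

End Lift.

Definition tens_scale (b : R) : idtensor -> idtensor :=
  tens_lift (fun a m => tens_pure (b * a) m).

Definition tens_theta (k : nat) : idtensor -> idtensor :=
  tens_lift (fun a m =>
    \sum_(i < k.+1) tens_pure (theta i a) (mtheta (k - i)%N m)).

Lemma tens_scale_pure b a m :
  tens_scale b (tens_pure a m) = tens_pure (b * a) m.
Proof.
apply: tens_lift_pure => *.
- by rewrite mulrDr tens_pureDl.
- by rewrite tens_pureDr.
- by rewrite mulrA tens_pureZ.
Qed.

Lemma tens_scaleDr b t u : tens_scale b (t + u) = tens_scale b t + tens_scale b u.
Proof.
apply: tens_liftD => *.
- by rewrite mulrDr tens_pureDl.
- by rewrite tens_pureDr.
- by rewrite mulrA tens_pureZ.
Qed.

Lemma tens_scale0r b : tens_scale b 0 = 0.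
Proof. by apply: (addrI (tens_scale b 0)); rewrite -tens_scaleDr !addr0. Qed.

Lemma tens_scaleA a b t : tens_scale a (tens_scale b t) = tens_scale (a * b) t.
Proof.
elim/tens_ind: t => [|t u h1 h2|c m]; first by rewrite !tens_scale0r.
- by rewrite !tens_scaleDr h1 h2.
- by rewrite !tens_scale_pure mulrA.
Qed.

Lemma tens_scale1 : left_id 1 tens_scale.
Proof.
move=> t; elim/tens_ind: t => [|t u h1 h2|c m]; first by rewrite !tens_scale0r.
- by rewrite !tens_scaleDr h1 h2.
- by rewrite !tens_scale_pure mul1r.
Qed.

Lemma tens_scaleDl t : {morph tens_scale^~ t : a b / a + b}.
Proof.
move=> a b; elim/tens_ind: t => [|t u h1 h2|c m].
- by rewrite !tens_scale0r addr0.
- by rewrite !tens_scaleDr h1 h2 addrACA.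
- by rewrite !tens_scale_pure mulrDl tens_pureDl.
Qed.

HB.instance Definition _ := GRing.Zmodule_isLmodule.Build R idtensor
  tens_scaleA tens_scale1 tens_scaleDr tens_scaleDl.

Lemma tens_pureE b a m : b *: tens_pure a m = tens_pure (b * a) m.
Proof. exact: tens_scale_pure. Qed.

Section ThetaBalanced.
Variable k : nat.
Let h (a : R) (m : M) :=
  \sum_(i < k.+1) tens_pure (theta i a) (mtheta (k - i)%N m).

Let hDl a b m : h (a + b) m = h a m + h b m.
Proof.
by rewrite -big_split; apply: eq_bigr => i _; rewrite thetaD tens_pureDl.
Qed.

Let hDr a m n : h a (m + n) = h a m + h a n.
Proof.
by rewrite -big_split; apply: eq_bigr => i _; rewrite mthetaD tens_pureDr.
Qed.

Let hZ a s m : h (a * f s) m = h a (s *: m).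
Proof.
rewrite /h; under eq_bigr do rewrite thetaM tens_pure_suml.
rewrite (big_triple (fun i j l =>
  tens_pure (theta i a * theta j (f s)) (mtheta l m))).
apply: eq_bigr => i _; rewrite mthetaZ tens_pure_sumr.
by apply: eq_bigr => j _; rewrite tens_pureZ idmorphE.
Qed.

Lemma tens_theta_pure a m : tens_theta k (tens_pure a m) =
  \sum_(i < k.+1) tens_pure (theta i a) (mtheta (k - i)%N m).
Proof. exact: tens_lift_pure hDl hDr hZ a m. Qed.

Lemma tens_thetaD t u : tens_theta k (t + u) = tens_theta k t + tens_theta k u.
Proof. exact: tens_liftD hDl hDr hZ t u. Qed.

Lemma tens_theta_at0 : tens_theta k 0 = 0.
Proof. exact: tens_lift0 hDl hDr hZ. Qed.

Lemma tens_theta_sum I (r : seq I) (P : pred I) (F : I -> idtensor) :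
  tens_theta k (\sum_(i <- r | P i) F i) = \sum_(i <- r | P i) tens_theta k (F i).
Proof. exact: (big_morph _ tens_thetaD tens_theta_at0). Qed.

End ThetaBalanced.

Lemma tens_thetaZ k r t : tens_theta k (r *: t) =
  \sum_(i < k.+1) theta i r *: tens_theta (k - i)%N t.
Proof.
elim/tens_ind: t => [|t u h1 h2|a m].
- rewrite scaler0 tens_theta_at0 big1 // => i _.
  by rewrite tens_theta_at0 scaler0.
- rewrite scalerDr tens_thetaD h1 h2 -big_split; apply: eq_bigr => i _.
  by rewrite tens_thetaD scalerDr.
- rewrite tens_pureE tens_theta_pure.
  under eq_bigr do rewrite thetaM tens_pure_suml.
  rewrite (big_triple (fun i j l =>
    tens_pure (theta i r * theta j a) (mtheta l m))).
  apply: eq_bigr => i _; rewrite tens_theta_pure scaler_sumr.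
  by apply: eq_bigr => j _; rewrite tens_pureE.
Qed.

Lemma tens_theta_0 t : tens_theta 0 t = t.
Proof.
elim/tens_ind: t => [|t u h1 h2|a m]; first by rewrite tens_theta_at0.
- by rewrite tens_thetaD h1 h2.
- by rewrite tens_theta_pure big_ord1 theta0 mtheta0.
Qed.

Lemma big_shift_bin (V : nmodType) (G : nat -> V) i j q : (q <= i)%N ->
  \sum_(p < j.+1) G (q + p)%N *+ ('C(q + p, q) * 'C(i + j - (q + p), i - q)) =
  \sum_(r < (i + j).+1) G r *+ ('C(r, q) * 'C(i + j - r, i - q)).
Proof.
move=> qi; rewrite -[RHS](big_mkord predT
  (fun r => G r *+ ('C(r, q) * 'C(i + j - r, i - q)))).
rewrite (big_cat_nat (n := q)) //=; last first.
  by rewrite ltnW // ltnS (leq_trans qi) // leq_addr.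
have -> : \sum_(0 <= r < q) G r *+ ('C(r, q) * 'C(i + j - r, i - q)) = 0.
  by rewrite big_nat big1 // => r /andP[_ h]; rewrite (bin_small h).
rewrite add0r.
rewrite (big_cat_nat (n := (q + j).+1)) //=; last 2 first.
- by rewrite ltnW // ltnS leq_addr.
- by rewrite ltnS leq_add2r.
have -> : \sum_((q + j).+1 <= r < (i + j).+1)
    G r *+ ('C(r, q) * 'C(i + j - r, i - q)) = 0.
  rewrite big_nat big1 // => r /andP[h1 h2].
  by rewrite (@bin_small (i + j - r)) ?muln0 //; lia.
rewrite addr0 -{6}[q]add0n big_addn -addnS addKn big_mkord.
by apply: eq_bigr => p _; rewrite addnC.
Qed.

Lemma tens_thetaC i j t :
  tens_theta i (tens_theta j t) = tens_theta (i + j)%N t *+ 'C(i + j, i).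
Proof.
elim/tens_ind: t => [|t u h1 h2|a m].
- by rewrite !tens_theta_at0 mul0rn.
- by rewrite !tens_thetaD h1 h2 mulrnDl.
rewrite !tens_theta_pure tens_theta_sum.
under eq_bigr do rewrite tens_theta_pure.
rewrite exchange_big /=.
pose G r := tens_pure (theta r a) (mtheta (i + j - r)%N m).
transitivity (\sum_(q < i.+1) \sum_(r < (i + j).+1)
    G r *+ ('C(r, q) * 'C(i + j - r, i - q))).
  apply: eq_bigr => q _; rewrite -(big_shift_bin G) ?leq_ord //.
  apply: eq_bigr => p _; rewrite thetaC mthetaC tens_pureMnl tens_pureMnr.
  have -> : (i - q + (j - p) = i + j - (q + p))%N.
    by have := ltn_ord q; have := ltn_ord p; lia.
  by rewrite -mulrnA mulnC.
rewrite exchange_big -sumrMnl; apply: eq_bigr => r _ /=.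
rewrite sumrMnr binomial.Vandermonde subnKC //; exact: leq_ord.
Qed.

Lemma tens_fingen : exists (n : nat) (g : 'I_n -> idtensor),
  forall t, exists c : 'I_n -> R, t = \sum_i c i *: g i.
Proof.
have [n [g hg]] := @mfingen S M; exists n, (fun i => tens_pure 1 (g i)).
move=> t; elim/tens_ind: t => [|t u [c1 ->] [c2 ->]|a m].
- by exists (fun=> 0); rewrite big1 // => i _; rewrite scale0r.
- exists (fun i => c1 i + c2 i); rewrite -big_split; apply: eq_bigr => i _.
  by rewrite scalerDl.
- have [c ->] := hg m; exists (fun i => a * f (c i)).
  rewrite tens_pure_sumr; apply: eq_bigr => i _.
  by rewrite tens_pureE mulr1 tens_pureZ.
Qed.

HB.instance Definition _ := isIDModule.Build R idtensor
  tens_thetaD tens_thetaZ tens_theta_0 tens_thetaC tens_fingen.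

End Tensor.

Section PicardVessiot.
Variables (S : idRingType) (M : idModType S).

Definition solution_ring (R : idRingType) (f : {idmorphism S -> R}) : Prop :=
  [/\ id_simple R,
      forall r : R, r \in constants R <-> exists2 c : S, c \in constants S & f c = r
    & trivial_idmod (idtensor f M)].

Definition picard_vessiot (R : idRingType) (f : {idmorphism S -> R}) : Prop :=
  solution_ring f /\
  forall (R' : idRingType) (f' : {idmorphism S -> R'}), solution_ring f' ->
    forall g : {idmorphism R' -> R}, (forall s, g (f' s) = f s) -> bijective g.

End PicardVessiot.

(* Main.v *)
Require Import Defs.
From HB Require Import structures.
From mathcomp Require Import all_boot all_algebra.
From mathcomp Require Import zify ring.
From mathcomp Require Import boolp classical_sets.

(** The idea is to solve the module by Taylor series, to cut down to a finitely
    generated ring, and to pass to a simple quotient.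

    Let [L] be the residue field of [S] at a maximal ideal.  Reducing the
    coefficients of [theta] gives an ID-map from [S] to power series over [L], and
    reducing the coefficients of theta_M gives horizontal maps from [M] to the
    same ring ([exists_fundamental_pseries]).  To turn them into an isomorphism
    of the extended module with a free one, [M] has to be projective.  It is,
    because the scalars that factor through a free module form an ID-ideal,
    nonzero since [M] has a maximal independent set of generators
    ([exists_dual_basis]).  A solution is recorded by two matrices [A] and [Y],
    the coordinates of an isomorphism and of its inverse ([fundamental]); their
    entries generate an ID-stable ring over [S], and a quotient of this ring by a
    maximal ID-ideal is the required ring [R0] ([exists_simple_fundamental]).

    Two facts about [R0] remain, and both rest on one extension theorem
    ([extension_generated]): if a domain [B] is finitely generated over a
    subdomain [A], then homomorphisms from [A] to an infinite field extend to
    [B], possibly after enlarging the field, as soon as they do not kill a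
    certain nonzero element of [A].

    First, [R0] has no new constants ([generated_constants]).  A new constant [c]
    would be transcendental over [S], as constants independent over the closed
    field [C] stay independent over [S] ([constants_dependent]).  But then [c]
    could be specialized to some element of [C], although its difference with
    that element is a unit.

    Second, [R0] maps to every solution ring [R1]
    ([exists_morphism_to_solution]).  Both rings map to a common field [K], hence
    by Taylor expansion to the power series over [K].  There the two fundamental
    matrices differ by a matrix with entries in [K] ([fundamental_change]).  The
    algebra generated over [C] by these entries has a point in [C], and since
    [R1] and [K] are linearly disjoint over [C] that point specializes the ring
    generated by [R1] and the entries to [R1] itself.

    The same comparison of fundamental matrices shows that an ID-map over [S]
    from a solution ring to [R0] is onto, so that [R0] is minimal.  Applying
    minimality of an arbitrary Picard-Vessiot ring to the map from [R0] identifies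
    it with [R0], whence uniqueness. *)

Set Implicit Arguments.
Unset Strict Implicit.
Unset Printing Implicit Defensive.

Import GRing.Theory.
Local Open Scope ring_scope.
Local Open Scope quotient_scope.

(** * Morphisms, subrings, quotients and maximal ideals *)

Lemma rmorphism_of (A B : comNzRingType) (g : A -> B) :
  zmod_morphism g -> monoid_morphism g ->
  exists G : {rmorphism A -> B}, forall x, G x = g x.
Proof.
move=> gB gM; pose G : {rmorphism A -> B} := HB.pack g
  (GRing.isZmodMorphism.Build A B g gB) (GRing.isMonoidMorphism.Build A B g gM).
by exists G.
Qed.

(** Used when an element has several representations: images are
    prescribed on representatives (polynomials, formal sums), and the condition
    on 0 is the well-definedness check. *)
Lemma rmorph_of_rel (A B : comNzRingType) (Rel : A -> B -> Prop) :
  (forall x, exists y, Rel x y) -> Rel 1 1 ->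
  (forall x y x' y', Rel x y -> Rel x' y' -> Rel (x - x') (y - y')) ->
  (forall x y x' y', Rel x y -> Rel x' y' -> Rel (x * x') (y * y')) ->
  (forall y, Rel 0 y -> y = 0) ->
  exists g : {rmorphism A -> B}, forall x y, Rel x y <-> y = g x.
Proof.
move=> tot R1 RB RM R0; have [g gP] := choice tot.
have uniq x y : Rel x y -> y = g x.
  move=> h; apply/eqP; rewrite -subr_eq0; apply/eqP/R0.
  by rewrite -(subrr x); apply: RB.
have gB : zmod_morphism g by move=> x y; apply/esym/uniq/RB; apply: gP.
have gM : monoid_morphism g.
  by split; [apply/esym/uniq/R1 | move=> x y; apply/esym/uniq/RM; apply: gP].
have [G GE] := rmorphism_of gB gM.
by exists G => x y; rewrite GE; split=> [/uniq|->] //; apply: gP.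
Qed.

Definition is_domain (R : comNzRingType) :=
  forall x y : R, x * y = 0 -> x = 0 \/ y = 0.
Definition is_field (R : comNzRingType) :=
  forall x : R, x <> 0 -> exists y, y * x = 1.

(** Rings carry no inverse operation here.  Classical choice supplies one, so
    that an integral domain or a field in the propositional sense can be used as
    an [idomainType] or a [fieldType] on the same carrier. *)
Section Classical_unit_ring.
Variable R : comNzRingType.
Definition cunit : pred R := fun x => `[< exists y, y * x = 1 >].
Definition cinv (x : R) : R :=
  if pselect (exists y, y * x = 1) is left h then sval (cid h) else x.

Lemma cmulVr : {in cunit, left_inverse 1 cinv *%R}.
Proof.
by move=> x /asboolP h; rewrite /cinv; case: pselect => // h'; case: cid.
Qed.
Lemma cunitP x y : y * x = 1 -> x \in cunit.
Proof. by move=> h; apply/asboolP; exists y. Qed.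
Lemma cinv_out : {in [predC cunit], cinv =1 id}.
Proof.
by move=> x; rewrite inE => /asboolP h; rewrite /cinv; case: pselect.
Qed.

Definition cunitring : comUnitRingType := HB.pack (GRing.ComNzRing.sort R)
  (GRing.ComNzRing_hasMulInverse.Build R cmulVr cunitP cinv_out).

Definition idomain_of (h : is_domain R) : idomainType.
Proof.
refine (HB.pack (GRing.ComNzRing.sort R) (GRing.ComUnitRing.class cunitring)
  (GRing.ComUnitRing_isIntegral.Build cunitring _)).
by move=> x y /h[]->; rewrite eqxx ?orbT.
Defined.

Lemma field_is_domain : is_field R -> is_domain R.
Proof.
move=> h x y xy0; case: (pselect (x = 0)) => [->|/h[z zx]]; [by left|right].
by rewrite -[y]mul1r -zx -mulrA xy0 mulr0.
Qed.

Definition field_of (h : is_field R) : fieldType.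
Proof.
refine (HB.pack (GRing.ComNzRing.sort R)
  (GRing.IntegralDomain.class (idomain_of (field_is_domain h)))
  (GRing.UnitRing_isField.Build cunitring _)).
by move=> x /eqP/h hx; apply/asboolP.
Defined.
End Classical_unit_ring.

Definition subring_set (R : comNzRingType) (D : set R) : Prop :=
  [/\ D 1, forall x y, D x -> D y -> D (x - y)
    & forall x y, D x -> D y -> D (x * y)].

Section Subring.
Variables (R : comNzRingType) (D : set R) (hD : subring_set D).

Lemma subring_set0 : D 0.
Proof. by case: hD => h1 hB _; rewrite -(subrr 1); apply: hB. Qed.

Lemma subring_setD x y : D x -> D y -> D (x + y).
Proof.
case: hD => h1 hB _ hx hy; rewrite -[y]opprK -[- y]sub0r.
by apply: (hB) => //; apply: (hB) => //; apply: subring_set0.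
Qed.

Lemma subring_set_sum I (r : seq I) (P : pred I) F :
  (forall i, P i -> D (F i)) -> D (\sum_(i <- r | P i) F i).
Proof.
move=> h; elim/big_ind: _ => //; [exact: subring_set0 | exact: subring_setD].
Qed.

Definition subring_pred of subring_set D : {pred R} := fun x => `[< D x >].

Lemma subring_pred_closed : subring_closed (subring_pred hD).
Proof.
case: hD => h1 hB hM; split; first exact/asboolP.
- by move=> x y /asboolP hx /asboolP hy; apply/asboolP/hB.
- by move=> x y /asboolP hx /asboolP hy; apply/asboolP/hM.
Qed.
HB.instance Definition _ :=
  GRing.isSubringClosed.Build R (subring_pred hD) subring_pred_closed.

Record subring := Subring {
  subring_val : R; subring_valP : subring_val \in subring_pred hD }.
HB.instance Definition _ := [isSub for subring_val].
HB.instance Definition _ := [Choice of subring by <:].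
HB.instance Definition _ := [SubChoice_isSubComNzRing of subring by <:].

Definition to_subring x (hx : D x) : subring := Subring (introT (asboolP _) hx).
Lemma subringP (x : subring) : D (val x).
Proof. exact/asboolP/subring_valP. Qed.
End Subring.

Definition subring_gen (R : comNzRingType) (X : set R) : set R :=
  fun x => forall D, subring_set D -> (forall y, X y -> D y) -> D x.

Definition generates (R : comNzRingType) (X : set R) : Prop :=
  forall x, subring_gen X x.

Section SubringGen.
Variables (R : comNzRingType) (X : set R).

Lemma subring_gen_set : subring_set (subring_gen X).
Proof.
split=> [D [] //|x y hx hy D hD XD|x y hx hy D hD XD]; case: (hD) => _ hB hM.
- by apply: hB; [apply: hx | apply: hy].
- by apply: hM; [apply: hx | apply: hy].
Qed.

Lemma sub_subring_gen x : X x -> subring_gen X x.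
Proof. by move=> hx D _; apply. Qed.

Definition gen_ring : comNzRingType := subring subring_gen_set.

(** Inside the subring generated by [X], the elements of [X] still generate:
    the image of a subring of [gen_ring] is a subring of [R]. *)
Lemma gen_ring_generates :
  generates (fun z : gen_ring => X (val z)).
Proof.
move=> z D hD XD.
pose D' : set R := fun x => exists2 y : gen_ring, D y & val y = x.
have hD' : subring_set D'.
  case: hD => h1 hB hM; split; first by exists 1.
  - by move=> _ _ [x hx <-] [y hy <-]; exists (x - y); [apply: hB|].
  - by move=> _ _ [x hx <-] [y hy <-]; exists (x * y); [apply: hM|].
have [|y hy /val_inj <- //] := subringP z D' hD'.
by move=> y hy; exists (to_subring subring_gen_set (sub_subring_gen hy)) => //; apply: XD.
Qed.
End SubringGen.

Definition ideal_set (R : comNzRingType) (I : set R) : Prop :=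
  [/\ I 0, forall x y, I x -> I y -> I (x + y)
    & forall a x, I x -> I (a * x)].

Section Quotient.
Variables (R : comNzRingType) (I : set R).
Definition proper_ideal_set : Prop := ideal_set I /\ ~ I 1.
Hypothesis hI : proper_ideal_set.

Definition ideal_pred of proper_ideal_set : {pred R} := fun x => `[< I x >].
Lemma ideal_pred_proper : 1 \notin ideal_pred hI /\
  forall a, {in ideal_pred hI, forall u, a * u \in ideal_pred hI}.
Proof.
case: hI => -[h0 hD hM] h1; split; first exact/asboolPn.
by move=> a x /asboolP hx; apply/asboolP/hM.
Qed.
Lemma ideal_pred_zmod : zmod_closed (ideal_pred hI).
Proof.
case: hI => -[h0 hD hM] h1; split; first exact/asboolP.
move=> x y /asboolP hx /asboolP hy; apply/asboolP/hD => //.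
by rewrite -mulN1r; apply: hM.
Qed.
HB.instance Definition _ := isProperIdeal.Build R (ideal_pred hI) ideal_pred_proper.
HB.instance Definition _ := GRing.isZmodClosed.Build R (ideal_pred hI) ideal_pred_zmod.

Definition quot_ring : comNzRingType := {ideal_quot (ideal_pred hI)}.
Definition quot_pi : {rmorphism R -> quot_ring} := \pi_{ideal_quot (ideal_pred hI)}.

Lemma quot_pi_eq0 x : quot_pi x = 0 <-> I x.
Proof.
rewrite -[0](rmorph0 quot_pi); split.
  by move=> /eqmodP; rewrite /= /Quotient.equiv subr0 => /asboolP.
by move=> h; apply/eqmodP; rewrite /= /Quotient.equiv subr0; apply/asboolP.
Qed.

Lemma quot_pi_surj y : exists x, quot_pi x = y.
Proof. by exists (repr y); exact: reprK. Qed.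
End Quotient.
Arguments quot_pi {R I} hI.
Arguments quot_pi_eq0 {R I} hI x.
Arguments quot_pi_surj {R I} hI y.

Section MaximalIdeal.
Variables (R : comNzRingType) (F : set (R -> R)).
Definition stable_ideal (I : set R) :=
  proper_ideal_set I /\ forall f x, F f -> I x -> I (f x).

(** One application of Zorn's lemma, with a set [F] of operators as parameter:
    [F] empty gives maximal ideals, [F] the set of all [theta k] gives maximal
    ID-ideals. *)
Lemma maximal_stable_ideal I0 : stable_ideal I0 ->
  exists I : set R, [/\ stable_ideal I, forall x, I0 x -> I x &
    forall J : set R, stable_ideal J -> (forall x, I x -> J x) -> forall x, J x -> I x].
Proof.
move=> h0.
(* The union of an empty chain is empty, so the empty set is admitted too. *)
pose P (A : set R) := (forall x, ~ A x) \/
  (stable_ideal A /\ forall x, I0 x -> A x).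
have [|A [PA Amax]] := @Zorn_bigcup _ P.
- move=> G GP Gtot.
  case: (pselect (exists A, G A /\ exists x, A x)) => [[A [GA [z Az]]]|hn]; last first.
    by left=> x [A GA Ax]; apply: hn; exists A; split=> //; exists x.
  right.
  have good B : G B -> (exists x, B x) -> stable_ideal B /\ forall x, I0 x -> B x.
    by move=> /GP [h [x /h]|].
  have common x y : (\bigcup_(X in G) X)%classic x -> (\bigcup_(X in G) X)%classic y ->
      exists B, [/\ G B, B x & B y].
    move=> [B GB Bx] [B' GB' By]; case: (Gtot _ _ GB GB') => h.
      by exists B'; split=> //; apply: h.
    by exists B; split=> //; apply: h.
  have [gA A0] := good A GA (ex_intro _ _ Az).
  split; last by move=> x /A0; exists A.
  split; last first.
    move=> f x Ff [B GB Bx]; exists B => //.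
    by have [[_ hB] _] := good B GB (ex_intro _ _ Bx); apply: hB.
  split; last first.
    by move=> [B GB B1]; have [[[_ hB] _] _] := good B GB (ex_intro _ _ B1).
  split.
  - by exists A => //; case: gA => -[[]].
  - move=> x y hx hy; have [B [GB Bx By]] := common x y hx hy; exists B => //.
    by have [[[[_ hB _] _] _] _] := good B GB (ex_intro _ _ Bx); apply: hB.
  - move=> a x [B GB Bx]; exists B => //.
    by have [[[[_ _ hB] _] _] _] := good B GB (ex_intro _ _ Bx); apply: hB.
have [gA A0] : stable_ideal A /\ forall x, I0 x -> A x.
  case: PA => // h; exfalso; apply: (Amax I0); last by right.
  split=> [x /h //|/(_ 0) h']; apply: (h 0); apply: h'.
  by case: h0 => -[[]].
exists A; split=> // J gJ AJ x Jx; case: (pselect (A x)) => // nAx.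
exfalso; apply: (Amax J); first by split=> // /(_ x Jx).
by right; split=> // y /A0/AJ.
Qed.
End MaximalIdeal.

Lemma ideal_set_zero (R : comNzRingType) : proper_ideal_set [set (0 : R)]%classic.
Proof.
split; last by apply/eqP; apply: oner_neq0.
by split=> // [x y ->->|a x ->]; rewrite ?addr0 ?mulr0.
Qed.

Lemma exists_residue_field (R : comNzRingType) (I0 : set R) : proper_ideal_set I0 ->
  exists (L : fieldType) (h : {rmorphism R -> L}), forall x, I0 x -> h x = 0.
Proof.
move=> h0.
have [|I [[pI _] I0I Imax]] := @maximal_stable_ideal R (fun=> False) I0.
  by split.
have fld : is_field (quot_ring pI).
  move=> y; have [x <-] := quot_pi_surj pI y => nx.
  case: (pselect (exists2 a, I a & exists b, a + b * x = 1)).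
    move=> [a Ia [b abx]]; exists (quot_pi pI b).
    rewrite -rmorphM -[RHS](rmorph1 (quot_pi pI)) -abx rmorphD.
    by rewrite ((quot_pi_eq0 pI a).2 Ia) add0r.
  move=> hn; exfalso; apply: nx; apply/quot_pi_eq0.
  apply: (Imax (fun z => exists2 a, I a & exists b, a + b * x = z)).
  - split=> //; split=> //; case: (pI) => -[i0 iD iM] _; split.
    + by exists 0 => //; exists 0; rewrite mul0r addr0.
    + move=> _ _ [a Ia [b <-]] [a' Ia' [b' <-]]; exists (a + a'); first exact: iD.
      by exists (b + b'); rewrite mulrDl addrACA.
    + move=> c _ [a Ia [b <-]]; exists (c * a); first exact: iM.
      by exists (c * b); rewrite mulrDr mulrA.
  - by move=> a Ia; exists a => //; exists 0; rewrite mul0r addr0.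
  - by exists 0; [case: (pI) => -[] | exists 1; rewrite mul1r add0r].
exists (field_of fld), (quot_pi pI) => x /I0I; exact: (quot_pi_eq0 pI x).2.
Qed.

(** Kronecker's construction, except that the modulus need not be irreducible:
    a maximal ideal containing [p] does the factoring. *)
Lemma exists_root_extension (L : fieldType) (p : {poly L}) : (1 < size p)%N ->
  exists (L' : fieldType) (i : {rmorphism L -> L'}) (x : L'), root (map_poly i p) x.
Proof.
move=> sp.
have [|L' [h h0]] := @exists_residue_field {poly L} (fun q => p %| q).
  split; last by rewrite dvdp1; apply/negP; rewrite neq_ltn sp orbT.
  split; [exact: dvdp0 | exact: dvdp_add | by move=> a x; apply: dvdp_mull].
exists L', (h \o polyC), (h 'X); apply/rootP; rewrite map_poly_comp.
by rewrite horner_map -/(comp_poly 'X p) comp_polyXr h0.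
Qed.

(** * Extending homomorphisms into fields *)

Definition infinite_field (L : fieldType) :=
  forall n, exists s : seq L, uniq s /\ size s = n.

Lemma infinite_field_ext (L L' : fieldType) (i : {rmorphism L -> L'}) :
  infinite_field L -> infinite_field L'.
Proof.
move=> h n; have [s [us ss]] := h n; exists (map i s).
by rewrite size_map ss map_inj_uniq //; apply: fmorph_inj.
Qed.

Lemma infinite_nonroot (L : fieldType) (p : {poly L}) :
  infinite_field L -> p != 0 -> exists x, p.[x] != 0.
Proof.
move=> h p0; have [s [us ss]] := h (size p).
case: (pselect (exists x, p.[x] != 0)) => // hn; exfalso.
have : all (root p) s.
  by apply/allP => x _; apply/negPn/negP => hx; apply: hn; exists x.
by move=> /(max_poly_roots p0)/(_ us); rewrite ss ltnn.
Qed.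

Lemma closed_infinite (L : fieldType) :
  GRing.closed_field_axiom L -> infinite_field L.
Proof.
move=> h; elim=> [|n [s [us ss]]]; first by exists [::].
have [|x hx] := (PreClosedField.closed_nonrootP h (\prod_(a <- s) ('X - a%:P))) _.
  by rewrite monic_neq0 // monic_prod_XsubC.
by exists (x :: s); rewrite /= ss us andbT -root_prod_XsubC.
Qed.

Section Evaluation.
Variables (A B L : comNzRingType) (j : {rmorphism A -> B}) (b : B).
Hypothesis gen : forall x, exists p, x = (map_poly j p).[b].

Lemma evaluation_ext (psi : {rmorphism A -> L}) (x : L) :
  (forall p, (map_poly j p).[b] = 0 -> (map_poly psi p).[x] = 0) ->
  exists g : {rmorphism B -> L}, forall p, g (map_poly j p).[b] = (map_poly psi p).[x].
Proof.
move=> h; pose Rel y z := exists p, y = (map_poly j p).[b] /\ z = (map_poly psi p).[x].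
have [||||y [p [/esym/h <- ->]]|g hg] := @rmorph_of_rel B L Rel => //.
- by move=> y; have [p ->] := gen y; exists (map_poly psi p).[x], p.
- by exists 1; rewrite !rmorph1 !hornerC.
- move=> _ _ _ _ [p [-> ->]] [q [-> ->]]; exists (p - q).
  by rewrite !rmorphB /= !hornerD !hornerN.
- move=> _ _ _ _ [p [-> ->]] [q [-> ->]]; exists (p * q).
  by rewrite !rmorphM /= !hornerM.
- by exists g => p; apply/esym/hg; exists p.
Qed.
End Evaluation.

(** If [b] is transcendental over [A], then [u] is a polynomial in [b], and [b]
    may be sent anywhere outside the finitely many roots of its image.  If [b] is
    algebraic, let [p] be a relation of minimal degree: once its leading
    coefficient survives in [L], sending [b] to a root of the image of [p] is well
    defined, by pseudo-division; and since [p] is coprime to any [f] with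
    [f.[b] = u], some nonzero constant of [A] is a multiple of [u] in [B], so
    that [u] survives as soon as this constant does.  Only the second case can
    enlarge [L], and not when [L] is closed. *)
Lemma extension_step (A B : idomainType) (j : {rmorphism A -> B}) (b : B) :
  injective j -> (forall x, exists p, x = (map_poly j p).[b]) ->
  forall u, u != 0 -> exists2 a : A, a != 0 &
  forall (L : fieldType) (psi : {rmorphism A -> L}),
    infinite_field L -> psi a != 0 ->
  exists (L' : fieldType) (i : {rmorphism L -> L'}) (psi' : {rmorphism B -> L'}),
    [/\ forall x, psi' (j x) = i (psi x), psi' u != 0 &
      GRing.closed_field_axiom L -> GRing.closed_field_axiom L' /\
        exists k : {rmorphism L' -> L}, cancel i k].
Proof.
move=> jinj gen u u0; have [f uE] := gen u.
have f0 : f != 0 by apply: contraNneq u0 => f0; rewrite uE f0 rmorph0 horner0.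
have jC x : (map_poly j x%:P).[b] = j x by rewrite map_polyC hornerC.
case: (pselect (exists2 p : {poly A}, p != 0 & (map_poly j p).[b] = 0)); last first.
  move=> tr; exists (lead_coef f); first by rewrite lead_coef_eq0.
  move=> L psi Linf psi0.
  have [|x hx] := @infinite_nonroot L (map_poly psi f) Linf.
    by apply: contraNneq psi0 => h; rewrite lead_coefE -coef_map h coef0.
  have [p pb|g hg] := evaluation_ext gen (psi := psi) (x := x).
    case: (eqVneq p 0) => [->|p0]; first by rewrite rmorph0 horner0.
    by exfalso; apply: tr; exists p.
  exists L, idfun, g; split=> [y||]; last by split=> //; exists idfun.
    by rewrite -jC hg map_polyC hornerC.
  by rewrite uE hg.
move=> [p1 p10 p1b].
pose Q n := `[< exists p : {poly A}, [/\ p != 0, (map_poly j p).[b] = 0 & size p = n] >].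
have exQ : exists n, Q n by exists (size p1); apply/asboolP; exists p1.
case: (ex_minnP exQ) => _ /asboolP[p [p0 pb <-]] pmin.
have {pmin} minp g : (map_poly j g).[b] = 0 -> (size g < size p)%N -> g = 0.
  move=> gb sg; apply/eqP; apply: contraTT sg => g0; rewrite -leqNgt.
  by apply: pmin; apply/asboolP; exists g.
have jN0 x : (j x == 0) = (x == 0) by rewrite -(inj_eq jinj) rmorph0.
have evM q r : (map_poly j (q * r)).[b] = (map_poly j q).[b] * (map_poly j r).[b].
  by rewrite rmorphM hornerM.
have evZ c q : (map_poly j (c *: q)).[b] = j c * (map_poly j q).[b].
  by rewrite -mul_polyC evM jC.
have sp : (1 < size p)%N.
  rewrite ltnNge; apply/negP => /size1_polyC pE; move: pb p0.
  by rewrite pE jC => /eqP; rewrite jN0 => /eqP ->; rewrite eqxx.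
have cop : coprimep p f.
  rewrite coprimep_def eqn_leq andbC lt0n size_poly_eq0 gcdp_eq0 negb_and p0 /=.
  rewrite leqNgt; apply/negP => sg; have gp := dvdp_gcdl p f.
  have gf := dvdp_gcdr p f; set g := gcdp p f in sg gp gf.
  have gb : (map_poly j g).[b] = 0.
    have [[c q] /= c0 pq] := Pdiv.Idomain.dvdpP _ _ gp.
    have : (map_poly j q).[b] * (map_poly j g).[b] == 0.
      by rewrite -evM -pq evZ pb mulr0.
    rewrite mulf_eq0 => /orP[/eqP qb|/eqP //].
    have q0 : q != 0.
      by apply: contraNneq p0 => q0; move/eqP: pq;
        rewrite q0 mul0r -mul_polyC mulf_eq0 polyC_eq0 (negPf c0).
    have g0 : g != 0 by rewrite -size_poly_gt0 ltnW.
    have : size p = (size q + size g).-1 by rewrite -size_mul // -pq size_scale.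
    move=> sE; rewrite (minp q qb) ?eqxx // in q0.
    by move: sg sE; move: (size g) (size p) (size q) => x y z; clear; lia.
  have [[c q] /= c0 fq] := Pdiv.Idomain.dvdpP _ _ gf.
  have : j c * u == 0 by rewrite uE -evZ fq evM gb mulr0.
  by rewrite mulf_eq0 jN0 (negPf c0) (negPf u0).
have [[w1 w2] /= /eqpP[[c1 c2] /= /andP[c10 c20] bez]] := Bezout_coprimepP _ _ cop.
exists (lead_coef p * c2); first by rewrite mulf_neq0 ?lead_coef_eq0.
move=> L psi Linf; rewrite rmorphM mulf_eq0 negb_or => /andP[pl pc2].
have [L' [i [x [xroot Lclosed]]]] : exists (L' : fieldType) (i : {rmorphism L -> L'})
    (x : L'), (map_poly (i \o psi) p).[x] = 0 /\
    (GRing.closed_field_axiom L -> GRing.closed_field_axiom L' /\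
        exists k : {rmorphism L' -> L}, cancel i k).
  have sp' : size (map_poly psi p) = size p by rewrite size_map_poly_id0.
  case: (pselect (GRing.closed_field_axiom L)) => [cl|ncl].
    have [|x /rootP hx] := (PreClosedField.closed_rootP cl (map_poly psi p)) _.
      by rewrite sp' neq_ltn sp orbT.
    by exists L, idfun, x; split; [exact: hx | split=> //; exists idfun].
  have [|L' [i [x /rootP hx]]] := @exists_root_extension L (map_poly psi p).
    by rewrite sp'.
  by exists L', i, x; rewrite map_poly_comp.
have [q qb|g hg] := evaluation_ext gen (psi := i \o psi) (x := x).
  have dq := Pdiv.Idomain.divp_eq q p.
  have r0 : q %% p = 0.
    apply: minp; last by rewrite ltn_modp.
    have -> : q %% p = lead_coef p ^+ scalp q p *: q - q %/ p * p by rewrite dq addrC addKr.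
    by rewrite rmorphB hornerD hornerN evM pb mulr0 subr0 evZ qb mulr0.
  rewrite r0 addr0 in dq.
  have : (i \o psi) (lead_coef p ^+ scalp q p) * (map_poly (i \o psi) q).[x] == 0.
    by rewrite -hornerZ -map_polyZ dq rmorphM hornerM xroot mulr0.
  rewrite mulf_eq0 /= !rmorphXn expf_eq0 fmorph_eq0 (negPf pl) andbF /=.
  by move/eqP.
exists L', i, g; split=> // [y|]; first by rewrite -jC hg map_polyC hornerC.
have : i (psi c2) != 0 by rewrite fmorph_eq0.
apply: contraNneq => gu; rewrite -[i _]/((i \o psi) c2) -(hornerC ((i \o psi) c2) x).
rewrite -map_polyC -[c2%:P]alg_polyC -bez map_polyZ hornerZ rmorphD hornerD !rmorphM !hornerM.
by rewrite xroot -(hg f) -uE gu !mulr0 addr0 mulr0.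
Qed.

Lemma subring_domain (B : idomainType) (D : set B) (hD : subring_set D) :
  is_domain (subring hD).
Proof.
move=> x y /(congr1 val)/eqP; rewrite rmorphM rmorph0 mulf_eq0.
by case/orP => /eqP h; [left | right]; apply: val_inj.
Qed.

(** This form of Chevalley's theorem is used three times: to compare two
    extensions of the same domain inside one field, to find a rational point of a
    finitely generated algebra over a closed field, and to rule out
    transcendental constants. *)
Lemma extension_generated (B : idomainType) (bs : seq B) :
  forall (A : idomainType) (j : {rmorphism A -> B}), injective j ->
  generates (fun x : B => (exists a, j a = x) \/ x \in bs) ->
  forall u, u != 0 -> exists2 a : A, a != 0 &
  forall (L : fieldType) (psi : {rmorphism A -> L}),
    infinite_field L -> psi a != 0 ->
  exists (L' : fieldType) (i : {rmorphism L -> L'}) (psi' : {rmorphism B -> L'}),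
    [/\ forall x, psi' (j x) = i (psi x), psi' u != 0 &
      GRing.closed_field_axiom L -> GRing.closed_field_axiom L' /\
        exists k : {rmorphism L' -> L}, cancel i k].
Proof.
elim: bs => [|b bs IH] A j jinj gen u u0.
  (* Without generators [j] is onto: this is the step for the element 0. *)
  apply: (@extension_step _ _ j 0) => // x.
  have [||a <-] := gen x (fun x => exists a, j a = x).
  - split=> [|_ _ [a <-] [b <-]|_ _ [a <-] [b <-]].
    + by exists 1; rewrite rmorph1.
    + by exists (a - b); rewrite rmorphB.
    + by exists (a * b); rewrite rmorphM.
  - by move=> y [].
  - by exists a%:P; rewrite map_polyC hornerC.
pose D : set B := fun x => exists p, x = (map_poly j p).[b].
have hD : subring_set D.
  split=> [|_ _ [p ->] [q ->]|_ _ [p ->] [q ->]].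
  - by exists 1; rewrite rmorph1 hornerC.
  - by exists (p - q); rewrite rmorphB hornerD hornerN.
  - by exists (p * q); rewrite rmorphM hornerM.
pose A1 : idomainType := idomain_of (@subring_domain B D hD).
pose v : {rmorphism A1 -> B} := (val : subring hD -> B).
have vinj : injective v by apply: val_inj.
have genv : generates (fun x : B => (exists a, v a = x) \/ x \in bs).
  move=> x E hE XE; apply: (gen x E hE) => y [[a <-]|].
    apply: XE; left; have h : D (j a) by exists a%:P; rewrite map_polyC hornerC.
    by exists (to_subring hD h).
  rewrite inE => /orP[/eqP ->|h]; apply: XE; [left|by right].
  have h : D b by exists 'X; rewrite map_polyX hornerX.
  by exists (to_subring hD h).
have [a1 a10 h1] := IH A1 v vinj genv u u0.
have D0 a : D (j a) by exists a%:P; rewrite map_polyC hornerC.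
pose j1f a : A1 := to_subring hD (D0 a).
have j1B : zmod_morphism j1f by move=> x y; apply: val_inj; rewrite /= rmorphB.
have j1M : monoid_morphism j1f.
  by split=> [|x y]; apply: val_inj; rewrite /= ?rmorph1 ?rmorphM.
pose j1 : {rmorphism A -> A1} := HB.pack j1f
  (GRing.isZmodMorphism.Build A A1 j1f j1B) (GRing.isMonoidMorphism.Build A A1 j1f j1M).
have vj1 x : v (j1 x) = j x by [].
have j1inj : injective j1 by move=> x y /(congr1 v); rewrite !vj1 => /jinj.
have Db : D b by exists 'X; rewrite map_polyX hornerX.
have gen1 x : exists p, x = (map_poly j1 p).[to_subring hD Db].
  have [p xp] := subringP x; exists p; apply: vinj; rewrite [LHS]xp.
  by rewrite -horner_map -map_poly_comp.
have [a a0 ha] := extension_step j1inj gen1 a10.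
exists a => // L psi Linf pa.
have [L1 [i1 [psi1 [e1 n1 c1]]]] := ha L psi Linf pa.
have [L2 [i2 [psi2 [e2 n2 c2]]]] := h1 L1 psi1 (infinite_field_ext i1 Linf) n1.
exists L2, (i2 \o i1), psi2; split=> // [x|cl].
  by rewrite -vj1 e2 e1.
have [cl1 [k1 k1K]] := c1 cl; have [cl2 [k2 k2K]] := c2 cl1.
by split=> //; exists (k1 \o k2); apply: can_comp.
Qed.

(** * Power series and Taylor maps *)

Definition pseries (R : comNzRingType) := nat -> R.

Section PowerSeries.
Variable R : comNzRingType.
Implicit Types f g h : pseries R.

HB.instance Definition _ := gen_eqMixin (pseries R).
HB.instance Definition _ := gen_choiceMixin (pseries R).

Definition ps_add f g : pseries R := fun k => f k + g k.
Definition ps_opp f : pseries R := fun k => - f k.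
Definition ps_mul f g : pseries R := fun k => \sum_(i < k.+1) f i * g (k - i)%N.
Definition ps_const (a : R) : pseries R := fun k => if k is 0%N then a else 0.

Lemma ps_addA : associative ps_add.
Proof. by move=> f g h; apply: funext => k; apply: addrA. Qed.
Lemma ps_addC : commutative ps_add.
Proof. by move=> f g; apply: funext => k; apply: addrC. Qed.
Lemma ps_add0 : left_id (fun=> 0) ps_add.
Proof. by move=> f; apply: funext => k; apply: add0r. Qed.
Lemma ps_addN : left_inverse (fun=> 0) ps_opp ps_add.
Proof. by move=> f; apply: funext => k; apply: addNr. Qed.

HB.instance Definition _ := GRing.isZmodule.Build (pseries R)
  ps_addA ps_addC ps_add0 ps_addN.

Lemma ps_mulA : associative ps_mul.
Proof.
move=> f g h; apply: funext => k; rewrite /ps_mul.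
under [RHS]eq_bigr do rewrite mulr_suml.
rewrite (big_triple (fun i j l => f i * g j * h l)).
apply: eq_bigr => i _; rewrite mulr_sumr; apply: eq_bigr => j _.
by rewrite mulrA.
Qed.

Lemma ps_mulC : commutative ps_mul.
Proof.
move=> f g; apply: funext => k; rewrite /ps_mul (reindex_inj rev_ord_inj) /=.
by apply: eq_bigr => i _; rewrite subSS subKn ?leq_ord // [LHS]mulrC.
Qed.

Lemma ps_constM a f k : ps_mul (ps_const a) f k = a * f k.
Proof.
rewrite /ps_mul big_ord_recl /= subn0 big1 ?addr0 // => i _.
by rewrite mul0r.
Qed.

Lemma ps_mul1 : left_id (ps_const 1) ps_mul.
Proof. by move=> f; apply: funext => k; rewrite ps_constM mul1r. Qed.

Lemma ps_mulD : left_distributive ps_mul +%R.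
Proof.
move=> f g h; apply: funext => k; rewrite -[RHS]big_split.
by apply: eq_bigr => i _; rewrite mulrDl.
Qed.

Lemma ps_one_neq0 : ps_const 1 != 0.
Proof.
apply/eqP => /(congr1 (fun f : pseries R => f 0%N)) /eqP.
by rewrite (negPf (oner_neq0 R)).
Qed.

HB.instance Definition _ := GRing.Zmodule_isComNzRing.Build (pseries R)
  ps_mulA ps_mulC ps_mul1 ps_mulD ps_one_neq0.

Lemma psD f g k : (f + g) k = f k + g k. Proof. by []. Qed.
Lemma psM f g k : (f * g) k = \sum_(i < k.+1) f i * g (k - i)%N.
Proof. by []. Qed.
Lemma ps_sum I (r : seq I) (P : pred I) (F : I -> pseries R) k :
  (\sum_(i <- r | P i) F i) k = \sum_(i <- r | P i) F i k.
Proof. by apply: (big_morph (fun f : pseries R => f k)). Qed.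

Lemma ps_const_zmod : zmod_morphism ps_const.
Proof. by move=> a b; apply: funext => -[|k] //; rewrite [RHS]subr0. Qed.
Lemma ps_const_monoid : monoid_morphism ps_const.
Proof.
split=> // a b; apply: funext => k; rewrite [RHS]ps_constM.
by case: k => //= k; rewrite mulr0.
Qed.
HB.instance Definition _ :=
  GRing.isZmodMorphism.Build R (pseries R) ps_const ps_const_zmod.
HB.instance Definition _ :=
  GRing.isMonoidMorphism.Build R (pseries R) ps_const ps_const_monoid.

(** The coefficients of f(T + U), expanded in powers of U. *)
Definition ps_theta k f : pseries R := fun j => f (j + k)%N *+ 'C(j + k, k).

Lemma ps_thetaD k f g : ps_theta k (f + g) = ps_theta k f + ps_theta k g.
Proof. by apply: funext => j; rewrite /ps_theta mulrnDl. Qed.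

Lemma ps_theta_const k a :
  ps_theta k (ps_const a) = if k is 0%N then ps_const a else 0.
Proof.
apply: funext => j; case: k => [|k]; rewrite /ps_theta.
  by rewrite addn0 bin0 mulr1n.
by rewrite addnS mul0rn.
Qed.

Lemma ps_thetaM k f g :
  ps_theta k (f * g) = \sum_(i < k.+1) ps_theta i f * ps_theta (k - i) g.
Proof.
apply: funext => j; rewrite ps_sum.
pose G r := f r * g (k + j - r)%N.
transitivity (\sum_(q < k.+1) \sum_(r < (k + j).+1)
    G r *+ ('C(r, q) * 'C(k + j - r, k - q))); last first.
  apply: eq_bigr => q _; rewrite -(big_shift_bin G) ?leq_ord //.
  apply: eq_bigr => p _; rewrite /ps_theta /G mulrnAl mulrnAr -mulrnA.
  have -> : (j - p + (k - q) = k + j - (q + p))%N.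
    by have := ltn_ord q; have := ltn_ord p; lia.
  by rewrite mulnC [(p + q)%N]addnC.
rewrite exchange_big /= /ps_theta addnC psM -sumrMnl; apply: eq_bigr => r _ /=.
rewrite sumrMnr binomial.Vandermonde subnKC //; exact: leq_ord.
Qed.

Lemma ps_theta0 f : ps_theta 0 f = f.
Proof. by apply: funext => j; rewrite /ps_theta addn0 bin0. Qed.

Lemma ps_thetaC i j f :
  ps_theta i (ps_theta j f) = ps_theta (i + j) f *+ 'C(i + j, i).
Proof.
apply: funext => k; rewrite /ps_theta.
transitivity (f (k + i + j)%N *+ ('C(k + i + j, j) * 'C(k + i, i))).
  by rewrite mulrnA.
have -> : forall (h : pseries R) n, (h *+ n) k = h k *+ n.
  by move=> h; elim=> // n IH; rewrite !mulrS psD IH.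
rewrite -mulrnA addnA; congr (_ *+ _).
have h1 := @bin_fact (k + i + j) j; have h2 := @bin_fact (k + i) i.
have h3 := @bin_fact (k + i + j) (i + j); have h4 := @bin_fact (i + j) i.
rewrite addnK in h1; rewrite addnK in h2; rewrite -addnA addnK addnA in h3.
rewrite addKn in h4.
move: (h1 (leq_addl _ _)) (h2 (leq_addl _ _)) (h4 (leq_addr _ _)) => e1 e2 e4.
have e3 := h3 ltac:(lia).
apply/eqP; rewrite -(eqn_pmul2r (fact_gt0 i)) -(eqn_pmul2r (fact_gt0 j)).
rewrite -(eqn_pmul2r (fact_gt0 k)); apply/eqP.
transitivity ((k + i + j)`!); first by rewrite -e1 -e2; ring.
by rewrite -e3 -e4; ring.
Qed.

HB.instance Definition _ := isIDRing.Build (pseries R)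
  ps_thetaD (fun k => ps_theta_const k 1) ps_thetaM ps_theta0 ps_thetaC.

Lemma ps_thetaE k f j : theta k f j = f (j + k)%N *+ 'C(j + k, k).
Proof. by []. Qed.

Lemma ps_constantE f : f \in constants (pseries R) -> f = ps_const (f 0%N).
Proof.
move=> /asboolP h; apply: funext => -[|k] //=.
move: (congr1 (fun g : pseries R => g 0%N) (h k.+1)).
by rewrite ps_thetaE add0n binn mulr1n.
Qed.

Lemma ps_const_constant a : ps_const a \in constants (pseries R).
Proof. by apply/asboolP => k; apply: ps_theta_const. Qed.
End PowerSeries.

(** Any ring homomorphism to [L] becomes an ID-homomorphism to power series
    over [L].  This is how fields without derivations, which are easy to
    construct, give ID-rings. *)
Section Taylor.
Variables (R : idRingType) (L : comNzRingType) (h : {rmorphism R -> L}).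

Definition taylor (x : R) : pseries L := fun k => h (theta k x).

Lemma taylor_zmod : zmod_morphism taylor.
Proof. by move=> x y; apply: funext => k; rewrite /taylor !raddfB. Qed.
Lemma taylor_monoid : monoid_morphism taylor.
Proof.
split=> [|x y]; apply: funext => k; rewrite /taylor.
  by rewrite theta1; case: k => [|k]; rewrite ?rmorph1 ?rmorph0.
by rewrite thetaM rmorph_sum psM; apply: eq_bigr => i _; rewrite rmorphM.
Qed.
Lemma taylor_id k x : taylor (theta k x) = theta k (taylor x).
Proof. by apply: funext => j; rewrite ps_thetaE /taylor thetaC rmorphMn
  -['C(j + k, k)]bin_sub ?leq_addl // addnK. Qed.

HB.instance Definition _ :=
  GRing.isZmodMorphism.Build R (pseries L) taylor taylor_zmod.
HB.instance Definition _ :=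
  GRing.isMonoidMorphism.Build R (pseries L) taylor taylor_monoid.
HB.instance Definition _ := isIDMorphism.Build R (pseries L) taylor taylor_id.

Lemma taylor_0 x : taylor x 0%N = h x.
Proof. by rewrite /taylor theta0. Qed.
End Taylor.

(** * ID-simple rings *)

Definition id_stable (R : idRingType) (D : set R) :=
  forall k x, D x -> D (theta k x).

Section IDSubring.
Variables (R : idRingType) (D : set R) (hD : subring_set D) (hT : id_stable D).
Definition id_subring of id_stable D := subring hD.
Local Notation T := (id_subring hT).
HB.instance Definition _ := GRing.ComNzRing.on T.

Let v : {rmorphism subring hD -> R} := val.

Definition subring_theta k (x : T) : T := to_subring hD (hT k (subringP x)).

Lemma subring_thetaD k x y :
  subring_theta k (x + y) = subring_theta k x + subring_theta k y.
Proof. by apply: val_inj; rewrite /= thetaD. Qed.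
Lemma subring_theta1 k : subring_theta k 1 = if k is 0%N then 1 else 0.
Proof. by apply: val_inj; rewrite /= theta1; case: k. Qed.
Lemma subring_thetaM k x y : subring_theta k (x * y) =
  \sum_(i < k.+1) subring_theta i x * subring_theta (k - i)%N y.
Proof. by apply: val_inj; rewrite /= thetaM -[RHS]/(v _) rmorph_sum. Qed.
Lemma subring_theta0 x : subring_theta 0 x = x.
Proof. by apply: val_inj; rewrite /= theta0. Qed.
Lemma subring_thetaC i j x : subring_theta i (subring_theta j x) =
  subring_theta (i + j) x *+ 'C(i + j, i).
Proof. by apply: val_inj; rewrite /= thetaC -[RHS]/(v _) rmorphMn. Qed.
HB.instance Definition _ := isIDRing.Build T subring_thetaD subring_theta1
  subring_thetaM subring_theta0 subring_thetaC.

Definition id_subring_val (x : T) : R := val (x : subring hD).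
Lemma id_subring_val_zmod : zmod_morphism id_subring_val. Proof. by []. Qed.
Lemma id_subring_val_monoid : monoid_morphism id_subring_val. Proof. by []. Qed.
Lemma id_subring_val_id k x : id_subring_val (theta k x) = theta k (id_subring_val x).
Proof. by []. Qed.
HB.instance Definition _ :=
  GRing.isZmodMorphism.Build T R id_subring_val id_subring_val_zmod.
HB.instance Definition _ :=
  GRing.isMonoidMorphism.Build T R id_subring_val id_subring_val_monoid.
HB.instance Definition _ := isIDMorphism.Build T R id_subring_val id_subring_val_id.
End IDSubring.

Section IDQuotient.
Variables (R : idRingType) (I : set R) (hI : proper_ideal_set I) (hT : id_stable I).
Definition id_quot of id_stable I : Type := quot_ring hI.
Local Notation T := (id_quot hT).
HB.instance Definition _ := GRing.ComNzRing.on T.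

Definition id_quot_pi : R -> T := quot_pi hI.
Lemma id_quot_pi_zmod : zmod_morphism id_quot_pi. Proof. exact: rmorphB. Qed.
Lemma id_quot_pi_monoid : monoid_morphism id_quot_pi.
Proof. by split; [apply: rmorph1 | apply: rmorphM]. Qed.
HB.instance Definition _ :=
  GRing.isZmodMorphism.Build R T id_quot_pi id_quot_pi_zmod.
HB.instance Definition _ :=
  GRing.isMonoidMorphism.Build R T id_quot_pi id_quot_pi_monoid.

Lemma id_quot_pi_eq0 x : id_quot_pi x = 0 <-> I x.
Proof. exact: quot_pi_eq0. Qed.
Lemma id_quot_pi_surj y : exists x, id_quot_pi x = y.
Proof. exact: quot_pi_surj. Qed.

Definition quot_theta k (y : T) : T := id_quot_pi (theta k (sval (cid (id_quot_pi_surj y)))).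
Lemma quot_theta_pi k x : quot_theta k (id_quot_pi x) = id_quot_pi (theta k x).
Proof.
rewrite /quot_theta; case: cid => z /= zx; apply/eqP; rewrite -subr_eq0 -!rmorphB.
by rewrite -raddfB; apply/eqP/id_quot_pi_eq0/hT/id_quot_pi_eq0; rewrite rmorphB /= zx subrr.
Qed.

Lemma quot_thetaD k x y : quot_theta k (x + y) = quot_theta k x + quot_theta k y.
Proof.
have [x' <-] := id_quot_pi_surj x; have [y' <-] := id_quot_pi_surj y.
by rewrite -rmorphD !quot_theta_pi raddfD rmorphD.
Qed.
Lemma quot_theta1 k : quot_theta k 1 = if k is 0%N then 1 else 0.
Proof.
rewrite -[1 in LHS](rmorph1 id_quot_pi) quot_theta_pi theta1.
by case: k => [|k]; rewrite ?rmorph1 ?rmorph0.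
Qed.
Lemma quot_thetaM k x y : quot_theta k (x * y) =
  \sum_(i < k.+1) quot_theta i x * quot_theta (k - i)%N y.
Proof.
have [x' <-] := id_quot_pi_surj x; have [y' <-] := id_quot_pi_surj y.
rewrite -rmorphM quot_theta_pi thetaM rmorph_sum.
by apply: eq_bigr => i _; rewrite !quot_theta_pi rmorphM.
Qed.
Lemma quot_theta0 x : quot_theta 0 x = x.
Proof. by have [x' <-] := id_quot_pi_surj x; rewrite quot_theta_pi theta0. Qed.
Lemma quot_thetaC i j x : quot_theta i (quot_theta j x) =
  quot_theta (i + j) x *+ 'C(i + j, i).
Proof.
by have [x' <-] := id_quot_pi_surj x; rewrite !quot_theta_pi thetaC rmorphMn.
Qed.
HB.instance Definition _ := isIDRing.Build T quot_thetaD quot_theta1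
  quot_thetaM quot_theta0 quot_thetaC.
Lemma id_quot_pi_id k x : id_quot_pi (theta k x) = theta k (id_quot_pi x).
Proof. exact/esym/quot_theta_pi. Qed.
HB.instance Definition _ := isIDMorphism.Build R T id_quot_pi id_quot_pi_id.
End IDQuotient.

Lemma id_simple_or (R : idRingType) (I : set R) : id_simple R -> is_id_ideal I ->
  (forall x, I x -> x = 0) \/ (forall x, I x).
Proof. by move=> sR /sR[->|->]; [left|right]. Qed.

(** The quotient by a maximal ID-ideal: an ID-ideal of the quotient has an
    ID-ideal as inverse image. *)
Lemma exists_id_simple_quotient (R : idRingType) :
  exists (Q : idRingType) (p : {idmorphism R -> Q}),
    id_simple Q /\ forall y, exists x, p x = y.
Proof.
pose F : set (R -> R) := fun f => exists k, f = theta k.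
have [|I [[pI sI] _ Imax]] := @maximal_stable_ideal R F [set 0]%classic.
  split; first exact: ideal_set_zero.
  by move=> f x [k ->] ->; rewrite raddf0.
have hT : id_stable I by move=> k x; apply: sI; exists k.
exists (id_quot pI hT), (@id_quot_pi R I pI hT); split; last exact: id_quot_pi_surj.
move=> J [[J0 JD JM] JT].
case: (pselect (J 1)) => J1.
  by right; apply/seteqP; split=> // x _; rewrite -[x]mulr1; apply: JM.
left; apply/seteqP; split=> [y|_ ->] //; have [x <-] := id_quot_pi_surj y => Jx.
apply/id_quot_pi_eq0; move: (x) Jx; apply: Imax.
  split; last by move=> f x' [k ->] /= h; rewrite idmorphE; apply: JT.
  split; last by rewrite rmorph1.
  split=> [|a b ha hb|a b hb]; rewrite ?rmorph0 ?rmorphD ?rmorphM //.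
    exact: JD.
  exact: JM.
by move=> x' /(id_quot_pi_eq0 pI hT _) ->.
Qed.

Lemma theta_mul_const (Q : idRingType) k (x c : Q) : c \in constants Q ->
  theta k (x * c) = theta k x * c.
Proof.
move=> /asboolP cc; rewrite thetaM big_ord_recr /= subnn cc big1 ?add0r // => i _.
rewrite cc; case E: (k - i)%N => [|m]; last by rewrite mulr0.
by have := ltn_ord i; move: E => /= + ?; lia.
Qed.

Section IDSimple.
Variables (R : idRingType) (sR : id_simple R).

Lemma id_simple_const_unit (c : R) : c \in constants R -> c <> 0 ->
  exists2 d, d \in constants R & d * c = 1.
Proof.
move=> cc c0.
have [|h|h] := id_simple_or (I := fun x => exists d, d * c = x) sR.
- split; first split.
  + by exists 0; rewrite mul0r.
  + by move=> _ _ [d <-] [e <-]; exists (d + e); rewrite mulrDl.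
  + by move=> a _ [d <-]; exists (a * d); rewrite mulrA.
  + by move=> k _ [d <-]; exists (theta k d); rewrite theta_mul_const.
- by case: c0; apply: h; exists 1; rewrite mul1r.
have [d dc] := h 1; exists d => //; apply/asboolP => -[|k]; first by rewrite theta0.
have := theta_mul_const k.+1 d cc.
rewrite dc theta1 => /(congr1 ( *%R d)); rewrite mulr0 mulrCA dc mulr1.
by move=> <-.
Qed.

Lemma const_ring_field : is_field (const_ring R).
Proof.
move=> x x0; have [|d dc dx] := id_simple_const_unit (const_valP x).
  by move=> h; apply: x0; apply: val_inj.
by exists (ConstRing dc); apply: val_inj.
Qed.

(** Compose [theta] with reduction modulo a maximal ideal.  The kernel of this
    map to power series over a field is a proper ID-ideal, hence zero; so each
    nonzero element has a first coefficient that does not reduce to 0, and the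
    first coefficients of two elements multiply. *)
Lemma id_simple_domain : is_domain R.
Proof.
have [L [h _]] := exists_residue_field (ideal_set_zero R).
have low x : x <> 0 -> exists i, h (theta i x) != 0 /\
    forall j, (j < i)%N -> h (theta j x) = 0.
  move=> x0; have ex : exists i, h (theta i x) != 0.
    apply: contrapT => hn; apply: x0.
    have [|k|/(_ 1)] := id_simple_or (I := fun x => forall k, h (theta k x) = 0) sR.
    + split; first split.
      * by move=> k; rewrite raddf0 rmorph0.
      * by move=> y z hy hz k; rewrite raddfD rmorphD hy hz addr0.
      * move=> a y hy k; rewrite thetaM rmorph_sum big1 // => i _.
        by rewrite rmorphM hy mulr0.
      * by move=> k y hy i; rewrite thetaC rmorphMn hy mul0rn.
    + by apply: k => i; apply/eqP/negPn/negP => hi; apply: hn; exists i.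
    + by move/(_ 0%N); rewrite theta0 rmorph1 => /eqP; rewrite oner_eq0.
  case: (ex_minnP ex) => i hi mini; exists i; split=> // j ji; apply/eqP.
  by apply: contraTT ji => /mini; rewrite -leqNgt.
move=> x y xy0; case: (pselect (x = 0)) => [|/low[i [xi xj]]]; first by left.
case: (pselect (y = 0)) => [|/low[j [yj yk]]]; first by right.
have := congr1 (fun z => h (theta (i + j) z)) xy0; rewrite raddf0 rmorph0.
rewrite thetaM rmorph_sum (bigD1 (Ordinal (leq_addr j i : i < (i + j).+1)%N)) //=.
rewrite big1 ?addr0 => [/eqP|k ki].
  by rewrite addKn rmorphM mulf_eq0 (negPf xi) (negPf yj).
rewrite rmorphM; case: (ltngtP k i) => [/xj ->|ik|E]; first by rewrite mul0r.
  by rewrite yk ?mulr0 //; have := ltn_ord k; lia.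
by move: ki; rewrite -val_eqE /= E eqxx.
Qed.

Lemma idmorphism_inj (Q : idRingType) (f : {idmorphism R -> Q}) : injective f.
Proof.
have [|h|/(_ 1)] := id_simple_or (I := fun x => f x = 0) sR.
- split; first split.
  + exact: rmorph0.
  + by move=> x y /= hx hy; rewrite rmorphD /= hx hy addr0.
  + by move=> a x /= hx; rewrite rmorphM /= hx mulr0.
  + by move=> k x /= hx; rewrite idmorphE hx raddf0.
- move=> x y /eqP; rewrite -subr_eq0 -rmorphB => /eqP/h/eqP.
  by rewrite subr_eq0 => /eqP.
- by rewrite rmorph1 => /eqP; rewrite oner_eq0.
Qed.

(** Linear disjointness: constants of [Q] dependent over [R] are dependent over
    the constants of [R].  The first coefficients of the relations form an
    ID-ideal, so a nontrivial relation can be normalized to start with 1; then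
    each [theta k] with [k > 0] gives a shorter relation, unless all
    coefficients are constant. *)
Lemma constants_dependent (Q : idRingType) (f : {idmorphism R -> Q}) n :
  forall (l : 'I_n -> Q) (r : 'I_n -> R), (forall i, l i \in constants Q) ->
  \sum_i f (r i) * l i = 0 -> (exists i, r i <> 0) ->
  exists c : 'I_n -> R, [/\ forall i, c i \in constants R, exists i, c i <> 0
    & \sum_i f (c i) * l i = 0].
Proof.
elim: n => [|n IH] l r lc rel [i0 ri0]; first by case: (i0).
have tail (s : 'I_n.+1 -> R) : \sum_i f (s i) * l i = 0 -> s ord0 = 0 ->
    (exists i, s i <> 0) -> exists c : 'I_n.+1 -> R,
      [/\ forall i, c i \in constants R, exists i, c i <> 0
    & \sum_i f (c i) * l i = 0].
  move=> srel s0 [i si]; case: (unliftP ord0 i) => [j ij|i0']; last by rewrite i0' s0 in si.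
  have [|||c [cc [k ck] crel]] := IH (fun i => l (lift ord0 i)) (fun i => s (lift ord0 i)).
  - by move=> k; apply: lc.
  - by move: srel; rewrite big_ord_recl s0 rmorph0 mul0r add0r.
  - by exists j; rewrite -ij.
  exists (fun i => if unlift ord0 i is Some j then c j else 0); split.
  - by move=> k'; case: unlift => // ; rewrite rpred0.
  - by exists (lift ord0 k); rewrite liftK.
  - rewrite big_ord_recl unlift_none rmorph0 mul0r add0r -[RHS]crel.
    by apply: eq_bigr => k' _; rewrite liftK.
have [|h|h] := id_simple_or (I := fun x => exists s : 'I_n.+1 -> R,
    s ord0 = x /\ \sum_i f (s i) * l i = 0) sR.
- split; first split.
  + by exists (fun=> 0); split=> //; rewrite big1 // => i _; rewrite rmorph0 mul0r.
  + move=> _ _ [s [<- hs]] [t [<- ht]]; exists (fun i => s i + t i); split=> //.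
    by under eq_bigr do rewrite rmorphD mulrDl; rewrite big_split /= hs ht addr0.
  + move=> a _ [s [<- hs]]; exists (fun i => a * s i); split=> //.
    by under eq_bigr do rewrite rmorphM -mulrA; rewrite -mulr_sumr hs mulr0.
  + move=> k _ [s [<- hs]]; exists (fun i => theta k (s i)); split=> //.
    under eq_bigr do rewrite idmorphE -theta_mul_const //.
    by rewrite -raddf_sum hs raddf0.
- by apply: (tail r) => //; [apply: h; exists r | exists i0].
have [s [s0 hs]] := h 1.
case: (pselect (exists k i, theta k.+1 (s i) <> 0)) => [[k ks]|sc].
  apply: (tail (fun i => theta k.+1 (s i))) => //; last by rewrite s0 theta1.
  under eq_bigr do rewrite idmorphE -theta_mul_const //.
  by rewrite -raddf_sum hs raddf0.
exists s; split=> //; last by exists ord0; rewrite s0; apply/eqP; rewrite oner_eq0.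
move=> i; apply/asboolP => -[|k]; first by rewrite theta0.
by apply: contrapT => h'; apply: sc; exists k, i.
Qed.
End IDSimple.

(** * ID-modules over ID-simple rings are projective *)

Lemma triangle_exchange (V : nmodType) (G : nat -> nat -> V) n :
  \sum_(i < n.+1) \sum_(j < (n - i).+1) G i j =
  \sum_(j < n.+1) \sum_(i < (n - j).+1) G i j.
Proof.
rewrite -(big_triple (fun i j _ => G i j)) -(big_triple (fun j i _ => G i j)).
apply: eq_bigr => l _; rewrite (reindex_inj rev_ord_inj) /=.
by apply: eq_bigr => i _; rewrite subSS subKn // leq_ord.
Qed.

(** A finitely generated module is projective exactly when its identity is a
    sum of maps x |-> phi x *: m, and this is what the rest of the proof uses.
    The scalars [s] for which [s] times the identity has this form make up an
    ID-ideal, because the identity is constant under the derivations of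
    endomorphisms; hence it is enough to find one nonzero such [s]. *)
Section DualBasis.
Variables (S : idRingType) (sS : id_simple S) (M : idModType S).

Definition functional (phi : M -> S) :=
  (forall x y, phi (x + y) = phi x + phi y) /\ forall a x, phi (a *: x) = a * phi x.

Lemma functional0 phi : functional phi -> phi 0 = 0.
Proof. by case=> _ hZ; rewrite -(scale0r 0) hZ mul0r. Qed.

Lemma functional_sum phi I (r : seq I) (P : pred I) F : functional phi ->
  phi (\sum_(i <- r | P i) F i) = \sum_(i <- r | P i) phi (F i).
Proof. by move=> h; apply: (big_morph phi h.1 (functional0 h)). Qed.

Lemma mtheta_at0 k : mtheta k (0 : M) = 0.
Proof. by apply: (addrI (mtheta k 0)); rewrite -mthetaD !addr0. Qed.

Lemma mtheta_sum k I (r : seq I) (P : pred I) (F : I -> M) :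
  mtheta k (\sum_(i <- r | P i) F i) = \sum_(i <- r | P i) mtheta k (F i).
Proof. exact: (big_morph _ (mthetaD k) (mtheta_at0 k)). Qed.

(** The [psi i] are the higher derivatives of [phi] in the dual module, defined
    by the Leibniz rule for the pairing up to order [N]. *)
Lemma functional_theta phi N : functional phi ->
  exists psi : nat -> M -> S, [/\ forall c, functional (psi c),
    forall c x, (N <= c)%N -> psi c x = 0 &
    forall k x, (k < N)%N -> theta k (phi x) = \sum_(i < k.+1) psi i (mtheta (k - i) x)].
Proof.
move=> hphi; elim: N => [|N [psi [hf h0 hpsi]]].
  by exists (fun _ _ => 0); split=> // c; split=> *; rewrite ?addr0 ?mulr0.
pose new x := theta N (phi x) - \sum_(i < N.+1) psi i (mtheta (N - i) x).
have hnew : functional new.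
  split=> [x y|r x]; rewrite /new.
    rewrite hphi.1 thetaD addrACA -opprD -big_split /=; congr (_ - _).
    by apply: eq_bigr => i _; rewrite mthetaD (hf i).1.
  rewrite hphi.2 thetaM.
  have -> : \sum_(i < N.+1) psi i (mtheta (N - i) (r *: x)) =
      \sum_(b < N.+1) theta b r * \sum_(i < (N - b).+1) psi i (mtheta (N - b - i) x).
    under [RHS]eq_bigr do rewrite mulr_sumr.
    rewrite -(triangle_exchange (fun i b => theta b r * psi i (mtheta (N - b - i) x))).
    apply: eq_bigr => i _; rewrite mthetaZ (functional_sum _ _ _ (hf i)).
    by apply: eq_bigr => b _; rewrite (hf i).2 subnAC.
  rewrite -sumrB big_ord_recl /= subn0 theta0 -mulrBr [X in _ + X]big1 ?addr0 // => b _.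
  by rewrite hpsi ?subrr //= /bump /=; have := ltn_ord b; lia.
exists (fun i => if i == N then new else psi i); split.
- by move=> c; case: eqP.
- by move=> c x Nc; case: eqP => [|_]; [lia | apply: h0; lia].
- move=> k x; rewrite ltnS leq_eqVlt => /orP[/eqP->|kN].
    rewrite big_ord_recr /= eqxx subnn mtheta0 /new big_ord_recr /= subnn mtheta0.
    rewrite (h0 N) // addr0 addrC -[LHS](subrK (\sum_(i < N) psi i (mtheta (N - i) x))).
    congr (_ + _); apply: eq_bigr => i _; case: eqP => // E.
    by have := ltn_ord i; rewrite E ltnn.
  rewrite hpsi //; apply: eq_bigr => i _; case: eqP => // E.
  by have := ltn_ord i; rewrite E; lia.
Qed.

Definition factors_through_free (s : S) := exists (J : finType) (m : J -> M)
  (phi : J -> M -> S), (forall j, functional (phi j)) /\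
    forall x, s *: x = \sum_j phi j x *: m j.

(** For stability, both sides of s *: x = \sum_j phi j x *: m j are
    differentiated.  Subtracting the terms of lower order, which are known by
    induction, leaves theta k s *: x, written with the derivatives of the [phi j]
    and of the [m j]. *)
Lemma factors_through_free_id_ideal : is_id_ideal factors_through_free.
Proof.
split; first split.
- by exists 'I_0, (fun=> 0), (fun _ _ => 0); split=> [[]//|x]; rewrite big_ord0 scale0r.
- move=> s t [J [m [phi [hf hs]]]] [J' [m' [phi' [hf' hs']]]].
  exists (J + J')%type, (fun j => match j with inl j => m j | inr j => m' j end).
  exists (fun j => match j with inl j => phi j | inr j => phi' j end).
  split=> [[]//|x]; rewrite big_sumType /= scalerDl.
  by rewrite hs hs'.
- move=> a s [J [m [phi [hf hs]]]]; exists J, m, (fun j x => a * phi j x).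
  split=> [j|x]; last first.
    by rewrite -scalerA hs scaler_sumr; apply: eq_bigr => j _; rewrite scalerA.
  split=> [x y|b x]; first by rewrite (hf j).1 mulrDr.
  by rewrite (hf j).2 mulrCA.
- move=> N s [J [m [phi [hf hs]]]].
  have [psi hpsi] := choice (fun j => functional_theta N.+1 (hf j)).
  pose Psi c x := \sum_j \sum_(i < c.+1) psi j i x *: mtheta (c - i) (m j).
  have key k x : (k < N.+1)%N -> theta k s *: x = Psi k x.
    elim/ltn_ind: k x => k IH x kN.
    have : mtheta k (s *: x) = \sum_(p < k.+1) Psi (k - p)%N (mtheta p x).
      rewrite hs mtheta_sum exchange_big /=; apply: eq_bigr => j _.
      rewrite mthetaZ.
      have [_ _ hj] := hpsi j.
      under [LHS]eq_bigr => a _.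
        rewrite hj; last by have := ltn_ord a; lia.
        rewrite scaler_suml; over.
      rewrite (big_triple (fun i p l => psi j i (mtheta p x) *: mtheta l (m j))).
      rewrite (triangle_exchange (fun i p => psi j i (mtheta p x) *: mtheta (k - i - p) (m j))).
      by apply: eq_bigr => p _; apply: eq_bigr => i _; rewrite subnAC.
    rewrite mthetaZ (reindex_inj rev_ord_inj) /=.
    rewrite (eq_bigr (fun p : 'I_k.+1 => theta (k - p) s *: mtheta p x)); last first.
      by move=> p _; rewrite subSS subKn ?leq_ord.
    rewrite !big_ord_recl /= !subn0 !mtheta0.
    rewrite [X in _ + X = _](eq_bigr (fun i : 'I_k =>
      Psi (k - bump 0 i)%N (mtheta (bump 0 i) x))) => [/addIr //|i _].
    by rewrite IH //; rewrite /bump; have := ltn_ord i; lia.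
  exists (J * 'I_N.+1)%type, (fun p : J * 'I_N.+1 => mtheta (N - p.2) (m p.1)).
  exists (fun p : J * 'I_N.+1 => psi p.1 p.2); split=> [[j i]|x]; first by have [] := hpsi j.
  by rewrite key // /Psi pair_big.
Qed.

(** A nonzero scalar takes the module into a free submodule: keep a maximal
    independent family of generators, and multiply the scalars that bring the
    others into its span.  Torsion does no harm, as each dependence is an exact
    relation among finitely many generators. *)
Lemma exists_independent_subset n : forall (g : 'I_n -> M),
  exists (r : nat) (b : 'I_r -> M) (s : S),
  [/\ s <> 0, forall c, \sum_i c i *: b i = 0 -> forall i, c i = 0 &
    forall j, exists c : 'I_r -> S, s *: g j = \sum_i c i *: b i].
Proof.
elim: n => [|n IH] g.
  exists 0%N, (fun=> 0), 1; split; [by apply/eqP; rewrite oner_eq0|by move=> c _ []|].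
  by case.
have [r [b [s [s0 ind span]]]] := IH (fun j => g (lift ord0 j)).
case: (pselect (exists a c, a <> 0 /\ a *: g ord0 = \sum_i c i *: b i)).
  move=> [a [c [a0 gc]]]; exists r, b, (a * s); split=> // [as0|j].
    by case: (id_simple_domain sS as0).
  case: (unliftP ord0 j) => [j'|] ->.
    have [d hd] := span j'; exists (fun i => a * d i).
    by rewrite -scalerA hd scaler_sumr; apply: eq_bigr => i _; rewrite scalerA.
  exists (fun i => s * c i).
  by rewrite mulrC -scalerA gc scaler_sumr; apply: eq_bigr => i _; rewrite scalerA.
move=> hn; exists r.+1, (fun i => if unlift ord0 i is Some i' then b i' else g ord0), s.
have E c : \sum_(i < r.+1) c i *: (if unlift ord0 i is Some i' then b i' else g ord0) =
    c ord0 *: g ord0 + \sum_i c (lift ord0 i) *: b i.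
  by rewrite big_ord_recl unlift_none; congr (_ + _); apply: eq_bigr => i _; rewrite liftK.
split=> // [c|j]; rewrite ?E.
  move=> rel; have c0 : c ord0 = 0.
    apply: contrapT => c0; apply: hn; exists (c ord0), (fun i => - c (lift ord0 i)).
    split=> //; apply/eqP; rewrite -subr_eq0 -[X in _ == X]rel; apply/eqP; congr (_ + _).
    by rewrite -sumrN; apply: eq_bigr => i _; rewrite scaleNr opprK.
  move: rel; rewrite c0 scale0r add0r => /ind h i.
  by case: (unliftP ord0 i) => [i'|] ->.
case: (unliftP ord0 j) => [j'|] ->.
  have [d hd] := span j'.
  exists (fun i => if unlift ord0 i is Some i' then d i' else 0).
  rewrite E unlift_none scale0r add0r hd; apply: eq_bigr => i _.
  by rewrite liftK.
exists (fun i => if unlift ord0 i is Some i' then 0 else s).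
rewrite E unlift_none big1 ?addr0 // => i _.
by rewrite liftK scale0r.
Qed.

Lemma exists_dual_basis : exists (k : nat) (m : 'I_k -> M) (phi : 'I_k -> M -> S),
  (forall j, functional (phi j)) /\ forall x, x = \sum_j phi j x *: m j.
Proof.
have [n [g gen]] := @mfingen S M.
have [r [b [s [s0 ind span]]]] := exists_independent_subset g.
have coord x : exists c : 'I_r -> S, s *: x = \sum_i c i *: b i.
  have [c ->] := gen x; have [d hd] := choice span.
  exists (fun i => \sum_j c j * d j i).
  rewrite scaler_sumr; under eq_bigr do rewrite scalerA mulrC -scalerA hd scaler_sumr.
  rewrite exchange_big; apply: eq_bigr => i _; rewrite scaler_suml.
  by apply: eq_bigr => j _; rewrite scalerA.
have [phi hphi] := choice coord.
have uniq c d : \sum_i c i *: b i = \sum_i d i *: b i -> forall i, c i = d i.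
  move=> h i; apply/eqP; rewrite -subr_eq0; apply/eqP; move: i; apply: ind.
  by under eq_bigr do rewrite scalerBl; rewrite sumrB h subrr.
have [|h] := id_simple_or sS factors_through_free_id_ideal.
  move=> h; case: s0; apply: h; exists 'I_r, b, (fun i x => phi x i); split=> // i.
  split=> [x y|a x]; move: i; apply: uniq; rewrite -hphi.
    rewrite scalerDr !hphi -big_split; apply: eq_bigr => i _.
    by rewrite scalerDl.
  rewrite scalerA mulrC -scalerA hphi scaler_sumr; apply: eq_bigr => i _.
  by rewrite scalerA.
have [J [m [f [hf hid]]]] := h 1.
exists #|J|, (fun i => m (enum_val i)), (fun i => f (enum_val i)); split=> [j|x].
  exact: hf.
rewrite -[LHS]scale1r hid (reindex (fun i : 'I_#|J| => enum_val i)) //=.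
by apply: onW_bij; apply: enum_val_bij.
Qed.
End DualBasis.

(** * Fundamental matrices *)

Lemma map_theta_mulmx (R : idRingType) q a b c (A : 'M[R]_(a, b)) (B : 'M[R]_(b, c)) :
  map_mx (theta q) (A *m B) =
  \sum_(i < q.+1) map_mx (theta i) A *m map_mx (theta (q - i)) B.
Proof.
apply/matrixP => x y; rewrite summxE !mxE raddf_sum.
rewrite (eq_bigr _ (fun z _ => thetaM q (A x z) (B z y))) exchange_big.
by apply: eq_bigr => i _; rewrite mxE; apply: eq_bigr => z _; rewrite !mxE.
Qed.

Lemma map_theta0 (R : idRingType) a b (A : 'M[R]_(a, b)) : map_mx (theta 0) A = A.
Proof. by apply/matrixP => x y; rewrite mxE theta0. Qed.

(** A solution of [M] over [R] is a pair of mutually inverse ID-maps between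
    the extension of [M] to [R] and a free module with constant basis.  In
    coordinates: horizontal maps [alpha i] from [M] to [R], with matrix [A] on the
    generators, and a matrix [Y] that lists the coordinates, with respect to the
    dual basis, of the constant basis vectors.  As [M] is only projective, [A] and
    [Y] are rectangular: their products are the identity and the idempotent
    [gram] that presents [M]. *)
Section Fundamental.
Variables (S : idRingType) (M : idModType S).
Variables (k : nat) (m : 'I_k -> M) (phi : 'I_k -> M -> S).
Hypothesis phi_functional : forall j, functional (phi j).
Hypothesis dual_basis : forall x, x = \sum_j phi j x *: m j.

Definition gram : 'M[S]_k := \matrix_(j, l) phi l (m j).

Definition sol_matrix (R : idRingType) n (alpha : 'I_n -> M -> R) : 'M[R]_(k, n) :=
  \matrix_(j, i) alpha i (m j).

Record fundamental (R : idRingType) (f : {idmorphism S -> R}) n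
    (alpha : 'I_n -> M -> R) (Y : 'M[R]_(n, k)) : Prop := Fundamental {
  fundD : forall i x y, alpha i (x + y) = alpha i x + alpha i y;
  fundZ : forall i s x, alpha i (s *: x) = f s * alpha i x;
  fund_theta : forall i q x, alpha i (mtheta q x) = theta q (alpha i x);
  fund_YA : Y *m sol_matrix alpha = 1%:M;
  fund_AY : sol_matrix alpha *m Y = map_mx f gram }.

Section Data.
Variables (R : idRingType) (f : {idmorphism S -> R}) (n : nat).
Variables (alpha : 'I_n -> M -> R) (Y : 'M[R]_(n, k)).
Hypothesis fund : fundamental f alpha Y.
Local Notation A := (sol_matrix alpha).

Lemma fund0 i : alpha i 0 = 0.
Proof. by rewrite -(scale0r 0) (fundZ fund) rmorph0 mul0r. Qed.

Lemma fund_coord i x : alpha i x = \sum_j f (phi j x) * A j i.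
Proof.
rewrite {1}[x]dual_basis (big_morph (alpha i) (fundD fund i) (fund0 i)).
by apply: eq_bigr => j _; rewrite (fundZ fund) mxE.
Qed.

Lemma fund_gramA : map_mx f gram *m A = A.
Proof.
apply/matrixP => j i; rewrite !mxE fund_coord; apply: eq_bigr => l _.
by rewrite !mxE.
Qed.

Lemma fund_Ygram : Y *m map_mx f gram = Y.
Proof. by rewrite -(fund_AY fund) mulmxA (fund_YA fund) mul1mx. Qed.

Let bil i (a : R) (x : M) := a * alpha i x.
Let bilDl i a b x : bil i (a + b) x = bil i a x + bil i b x.
Proof. exact: mulrDl. Qed.
Let bilDr i a x y : bil i a (x + y) = bil i a x + bil i a y.
Proof. by rewrite /bil (fundD fund) mulrDr. Qed.
Let bilZ i a s x : bil i (a * f s) x = bil i a (s *: x).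
Proof. by rewrite /bil (fundZ fund) mulrA. Qed.

Let hat i : idtensor f M -> R := tens_lift (bil i).
Let hat_pure i a x : hat i (tens_pure f a x) = a * alpha i x.
Proof. exact: tens_lift_pure (bilDl i) (bilDr i) (bilZ i) a x. Qed.
Let hatD i t u : hat i (t + u) = hat i t + hat i u.
Proof. exact: tens_liftD (bilDl i) (bilDr i) (bilZ i) t u. Qed.
Let hat0 i : hat i 0 = 0.
Proof. exact: tens_lift0 (bilDl i) (bilDr i) (bilZ i). Qed.
Let hat_sum i I (r : seq I) (P : pred I) F :
  hat i (\sum_(x <- r | P x) F x) = \sum_(x <- r | P x) hat i (F x).
Proof. exact: (big_morph _ (hatD i) (hat0 i)). Qed.

Let hatZ i a t : hat i (a *: t) = a * hat i t.
Proof.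
elim/tens_ind: t => [|t u h1 h2|b x]; first by rewrite scaler0 hat0 mulr0.
- by rewrite scalerDr !hatD h1 h2 mulrDr.
- by rewrite tens_pureE !hat_pure mulrA.
Qed.
Let hat_theta i q t : hat i (mtheta q t) = theta q (hat i t).
Proof.
elim/tens_ind: t => [|t u h1 h2|b x]; first by rewrite mtheta_at0 hat0 raddf0.
- by rewrite mthetaD !hatD h1 h2 raddfD.
- rewrite [mtheta q _]tens_theta_pure hat_sum hat_pure thetaM.
  by apply: eq_bigr => p _; rewrite hat_pure (fund_theta fund).
Qed.

(** The basis vector [e i] is the sum of the [Y i j] times the [m j].  It is
    constant because the coordinate maps are horizontal and jointly injective,
    and send [e i] to constants. *)
Lemma fundamental_trivial : trivial_idmod (idtensor f M).
Proof.
pose e i : idtensor f M := \sum_j Y i j *: tens_pure f 1 (m j).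
have hat_e i l : hat l (e i) = (i == l)%:R.
  rewrite /e hat_sum; under eq_bigr do rewrite hatZ hat_pure mul1r.
  have := congr1 (fun B : 'M_n => B i l) (fund_YA fund).
  by rewrite !mxE => <-; apply: eq_bigr => j _; rewrite mxE.
have span1 j : tens_pure f 1 (m j) = \sum_i A j i *: e i.
  rewrite /e; under [RHS]eq_bigr do rewrite scaler_sumr.
  rewrite exchange_big /= {1}[m j]dual_basis tens_pure_sumr; apply: eq_bigr => l _.
  under [RHS]eq_bigr do rewrite scalerA.
  rewrite -scaler_suml tens_pureE tens_pureZ mul1r mulr1; congr tens_pure.
  have := congr1 (fun B : 'M_k => B j l) (fund_AY fund).
  by rewrite !mxE.
have span t : exists c, t = \sum_i c i *: e i.
  elim/tens_ind: t => [|t u [c ->] [d ->]|a x].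
  - by exists (fun=> 0); rewrite big1 // => i _; rewrite scale0r.
  - exists (fun i => c i + d i); rewrite -big_split; apply: eq_bigr => i _.
    by rewrite scalerDl.
  - exists (fun i => \sum_j a * f (phi j x) * A j i).
    rewrite [x in LHS]dual_basis tens_pure_sumr.
    under [RHS]eq_bigr do rewrite scaler_suml.
    rewrite exchange_big; apply: eq_bigr => j _.
    rewrite tens_pureZ -[X in tens_pure f X]mulr1 -tens_pureE span1 scaler_sumr.
    by apply: eq_bigr => i _; rewrite scalerA.
have hat_comb c l : hat l (\sum_i c i *: e i) = c l.
  rewrite hat_sum (bigD1 l) //= hatZ hat_e eqxx mulr1 big1 ?addr0 // => i il.
  by rewrite hatZ hat_e (negPf il) mulr0.
exists n, e; split; first split=> //.
  by move=> c hc i; rewrite -(hat_comb c) hc hat0.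
move=> i [|q]; first by rewrite mtheta0.
have [c hc] := span (mtheta q.+1 (e i)).
rewrite hc big1 // => l _; rewrite -(hat_comb c) -hc hat_theta hat_e.
by case: eqP => _; rewrite ?theta1 ?raddf0 ?scale0r.
Qed.

Definition fund_gens : set R := fun x => (exists s, f s = x) \/
  (exists j i, A j i = x) \/ exists i j, Y i j = x.

(** The derivatives of [A] are combinations of the entries of [A], since
    [alpha i] commutes with [theta].  Those of [Y] follow by induction on the
    order: Y A = 1 gives theta_q(Y) A in terms of lower derivatives, hence
    theta_q(Y) A Y = theta_q(Y) gram, and Y gram = Y then gives theta_q(Y). *)
Lemma fund_gens_stable : id_stable (subring_gen fund_gens).
Proof.
pose U := subring_gen fund_gens; have hU : subring_set U by apply: subring_gen_set.
have Uf s : U (f s) by apply: sub_subring_gen; left; exists s.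
have UA j i : U (A j i) by apply: sub_subring_gen; right; left; exists j, i.
have UY i j : U (Y i j) by apply: sub_subring_gen; right; right; exists i, j.
pose Umx a b (B : 'M[R]_(a, b)) := forall x y, U (B x y).
have UM a b c (B : 'M[R]_(a, b)) (B' : 'M_(b, c)) : Umx _ _ B -> Umx _ _ B' -> Umx _ _ (B *m B').
  move=> h h' x y; rewrite mxE; apply: (subring_set_sum hU) => z _.
  by case: hU => _ _; apply.
have UB a b (B B' : 'M[R]_(a, b)) : Umx _ _ B -> Umx _ _ B' -> Umx _ _ (B - B').
  by move=> h h' x y; rewrite !mxE; case: hU => _ hB _; apply: hB.
have Usum a b q (B : 'I_q -> 'M[R]_(a, b)) : (forall i, Umx _ _ (B i)) ->
    Umx _ _ (\sum_i B i).
  by move=> h x y; rewrite summxE; apply: (subring_set_sum hU) => i _; apply: h.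
have UAq q : Umx _ _ (map_mx (theta q) A).
  move=> j i; rewrite !mxE -(fund_theta fund) fund_coord.
  by apply: (subring_set_sum hU) => l _; case: hU => _ _ hM; apply: hM.
have UfE q : Umx _ _ (map_mx (theta q) (map_mx f gram)).
  by move=> j i; rewrite !mxE -idmorphE.
have UYq q : Umx _ _ (map_mx (theta q) Y).
  elim/ltn_ind: q => q IH.
  have e1 := map_theta_mulmx q Y A; rewrite big_ord_recr /= subnn map_theta0 in e1.
  have U1 : Umx _ _ (map_mx (theta q) Y *m A).
    move/eqP: e1; rewrite addrC -subr_eq => /eqP <-; apply: UB.
      rewrite (fund_YA fund) => x y; rewrite !mxE.
      case: eqP => _; rewrite ?theta1 ?raddf0; last exact: subring_set0.
      by case: (q); [case: hU | move=> _; apply: subring_set0].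
    by apply: Usum => i; apply: UM; [apply: IH | apply: UAq].
  have U2 : Umx _ _ (map_mx (theta q) Y *m map_mx f gram).
    by rewrite -(fund_AY fund) mulmxA; apply: UM.
  have := map_theta_mulmx q Y (map_mx f gram); rewrite fund_Ygram => ->.
  rewrite big_ord_recr /= subnn map_theta0 addrC.
  rewrite -[X in _ + X]opprK; apply: (UB) => //.
  rewrite -sumrN; apply: Usum => i; rewrite -mulNmx; apply: UM; last exact: UfE.
  by rewrite -[- _]sub0r; apply: UB; [move=> x y; rewrite mxE; apply: subring_set0 | apply: IH].
move=> q x hx; move: q.
apply: (hx (fun x => forall q, U (theta q x))).
  case: (hU) => h1 hB hM; split.
  - by case=> [|q]; rewrite theta1; [exact: h1 | exact: subring_set0 hU].
  - by move=> y z hy hz q; rewrite raddfB; exact: (hB _ _ (hy q) (hz q)).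
  - move=> y z hy hz q; rewrite thetaM; apply: (subring_set_sum hU) => i _.
    by apply: hM; [apply: hy | apply: hz].
move=> _ [[s <-]|[[j [i <-]]|[i [j <-]]]] q.
- by rewrite -idmorphE.
- by have := UAq q j i; rewrite mxE.
- by have := UYq q i j; rewrite mxE.
Qed.
End Data.

(** Conversely, the coordinates of 1 (x) x in a constant basis are the
    [alpha i x], and [Y] comes from the extension to [R] of the dual basis. *)
Lemma trivial_fundamental (R : idRingType) (f : {idmorphism S -> R}) :
  trivial_idmod (idtensor f M) ->
  exists n (alpha : 'I_n -> M -> R) Y, fundamental f alpha Y.
Proof.
move=> [n [e [[span ind] econst]]].
have uniq c d : \sum_i c i *: e i = \sum_i d i *: e i -> forall i, c i = d i.
  move=> h i; apply/eqP; rewrite -subr_eq0; apply/eqP; move: i; apply: ind.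
  by under eq_bigr do rewrite scalerBl; rewrite sumrB h subrr.
have [alpha0 hal] := choice (fun x => span (tens_pure f 1 x)).
pose alpha i x := alpha0 x i.
pose h j (a : R) (x : M) := a * f (phi j x).
have hDl j a b x : h j (a + b) x = h j a x + h j b x by exact: mulrDl.
have hDr j a x y : h j a (x + y) = h j a x + h j a y.
  by rewrite /h (phi_functional j).1 rmorphD mulrDr.
have hZ j a s x : h j (a * f s) x = h j a (s *: x).
  by rewrite /h (phi_functional j).2 rmorphM mulrA.
pose phat j : idtensor f M -> R := tens_lift (h j).
have phat_pure j a x : phat j (tens_pure f a x) = a * f (phi j x).
  exact: tens_lift_pure (hDl j) (hDr j) (hZ j) a x.
have phatD j t u : phat j (t + u) = phat j t + phat j u.
  exact: tens_liftD (hDl j) (hDr j) (hZ j) t u.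
have phat0 j : phat j 0 = 0 by exact: tens_lift0 (hDl j) (hDr j) (hZ j).
have phatZ j a t : phat j (a *: t) = a * phat j t.
  elim/tens_ind: t => [|t u h1 h2|b x]; first by rewrite scaler0 phat0 mulr0.
  - by rewrite scalerDr !phatD h1 h2 mulrDr.
  - by rewrite tens_pureE !phat_pure mulrA.
have tE t : t = \sum_j phat j t *: tens_pure f 1 (m j).
  elim/tens_ind: t => [|t u h1 h2|b x].
  - by rewrite big1 // => j _; rewrite phat0 scale0r.
  - rewrite {1}h1 {1}h2 -big_split; apply: eq_bigr => j _.
    by rewrite phatD scalerDl.
  - rewrite {1}[x]dual_basis tens_pure_sumr; apply: eq_bigr => j _.
    by rewrite phat_pure tens_pureE mulr1 tens_pureZ.
pose Y : 'M[R]_(n, k) := \matrix_(i, j) phat j (e i).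
exists n, alpha, Y; split.
- move=> i x y; move: i; apply: uniq; rewrite -hal tens_pureDr !hal -big_split.
  by apply: eq_bigr => i _; rewrite scalerDl.
- move=> i s x; move: i; apply: uniq; rewrite -hal tens_pureZ mul1r -[f s]mulr1.
  rewrite -tens_pureE hal scaler_sumr; apply: eq_bigr => i _.
  by rewrite scalerA mulr1.
- move=> i q x; move: i; apply: uniq; rewrite -hal.
  have -> : tens_pure f 1 (mtheta q x) = mtheta q (tens_pure f 1 x).
    rewrite [RHS]tens_theta_pure big_ord_recl theta0 subn0 big1 ?addr0 // => i _.
    by rewrite theta1 tens_pure0l.
  rewrite hal mtheta_sum; apply: eq_bigr => i _.
  rewrite mthetaZ big_ord_recr /= subnn mtheta0 big1 ?add0r // => p _.
  rewrite econst; case E: (q - p)%N => [|?]; last by rewrite scaler0.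
  by have := ltn_ord p; move: E => /= + ?; lia.
- apply/matrixP => i l; rewrite mxE [RHS]mxE.
  rewrite (eq_bigr (fun j => phat j (e i) * alpha l (m j))) => [|j _]; last by rewrite !mxE.
  apply: (uniq (fun l => \sum_j phat j (e i) * alpha l (m j)) (fun l => (i == l)%:R)).
  rewrite [RHS](bigD1 i) //= eqxx scale1r [X in _ = _ + X]big1 ?addr0; last first.
    by move=> l' li; rewrite eq_sym (negPf li) scale0r.
  rewrite [RHS]tE; under [LHS]eq_bigr do rewrite scaler_suml.
  rewrite exchange_big; apply: eq_bigr => j _; rewrite hal scaler_sumr.
  by apply: eq_bigr => l' _; rewrite scalerA.
- apply/matrixP => j l; rewrite !mxE.
  have := congr1 (phat l) (hal (m j)); rewrite phat_pure mul1r => ->.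
  rewrite (big_morph (phat l) (phatD l) (phat0 l)); apply: eq_bigr => i _.
  by rewrite phatZ !mxE.
Qed.

Lemma fundamental_push (R R' : idRingType) (f : {idmorphism S -> R})
    (f' : {idmorphism S -> R'}) (g : {idmorphism R -> R'}) n alpha (Y : 'M_(n, k)) :
  (forall s, g (f s) = f' s) -> fundamental f alpha Y ->
  fundamental f' (fun i x => g (alpha i x)) (map_mx g Y).
Proof.
move=> gf F; have AE : sol_matrix (fun i x => g (alpha i x)) = map_mx g (sol_matrix alpha).
  by apply/matrixP => j i; rewrite !mxE.
split.
- by move=> i x y; rewrite (fundD F) rmorphD.
- by move=> i s x; rewrite (fundZ F) rmorphM /= gf.
- by move=> i q x; rewrite (fund_theta F) idmorphE.
- by rewrite AE -map_mxM (fund_YA F) map_mx1.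
- rewrite AE -map_mxM (fund_AY F); apply/matrixP => j l.
  by rewrite !mxE /= gf.
Qed.

(** Two fundamental matrices over one ring differ by a constant matrix:
    differentiate A' = A G and cancel [A] on the left by means of [Y]. *)
Lemma fundamental_change (R : idRingType) (f : {idmorphism S -> R}) n n'
    (alpha : 'I_n -> M -> R) Y (alpha' : 'I_n' -> M -> R) Y' :
  fundamental f alpha Y -> fundamental f alpha' Y' ->
  let G := Y *m sol_matrix alpha' in
  [/\ sol_matrix alpha' = sol_matrix alpha *m G, Y = G *m Y' &
      forall i l, G i l \in constants R].
Proof.
move=> F F'; set A := sol_matrix alpha; set A' := sol_matrix alpha' => G.
have A'E : A' = A *m G by rewrite mulmxA (fund_AY F) (fund_gramA F').
split=> //; first by rewrite -mulmxA (fund_AY F') (fund_Ygram F).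
pose row x : 'rV[R]_n := \row_i alpha i x.
have rowE x l : alpha' l x = (row x *m G) 0 l.
  rewrite (fund_coord F'); transitivity (((\row_j f (phi j x)) *m A' : 'rV_n') 0 l).
    by rewrite mxE; apply: eq_bigr => j _; rewrite !mxE.
  rewrite A'E mulmxA; congr ((_ *m G) 0 l); apply/rowP => i.
  by rewrite !mxE (fund_coord F); apply: eq_bigr => j _; rewrite !mxE.
have thG q : (0 < q)%N -> map_mx (theta q) G = 0.
  elim/ltn_ind: q => q IH q0.
  case: q q0 IH => // q _ IH.
  have rth i x : map_mx (theta i) (row x) = row (mtheta i x).
    by apply/rowP => l; rewrite !mxE (fund_theta F).
  have key x : row x *m map_mx (theta q.+1) G = 0.
    have := map_theta_mulmx q.+1 (row x) G.
    have -> : map_mx (theta q.+1) (row x *m G) = row (mtheta q.+1 x) *m G.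
      by apply/rowP => l; rewrite mxE -!rowE (fund_theta F').
    rewrite big_ord_recl big_ord_recr /= subnn subn0 !rth mtheta0 map_theta0 big1 => [|i _].
      by rewrite add0r => /eqP; rewrite -[X in X == _]add0r => /eqP/addIr.
    rewrite IH ?mulmx0 // /bump /=; have := ltn_ord i; lia.
  rewrite -[LHS]mul1mx -(fund_YA F) -mulmxA.
  have -> : A *m map_mx (theta q.+1) G = 0; last by rewrite mulmx0.
  apply/row_matrixP => j; rewrite row_mul row0 -[RHS](key (m j)); congr (_ *m _).
  by apply/rowP => i; rewrite !mxE.
move=> i l; apply/asboolP => -[|q]; first by rewrite theta0.
by have := congr1 (fun B : 'M_(n, n') => B i l) (thG q.+1 isT); rewrite !mxE.
Qed.
End Fundamental.

(** * The generic solution ring *)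

Lemma comp_idmorph (A B C : idRingType) (f : {idmorphism A -> B})
  (g : {idmorphism B -> C}) q x : (g \o f) (theta q x) = theta q ((g \o f) x).
Proof. by rewrite /= !idmorphE. Qed.
HB.instance Definition _ (A B C : idRingType) (f : {idmorphism A -> B})
  (g : {idmorphism B -> C}) := isIDMorphism.Build A C (g \o f) (comp_idmorph f g).

Lemma idmorphism_of (A B : idRingType) (g : {rmorphism A -> B}) :
  (forall q x, g (theta q x) = theta q (g x)) ->
  exists G : {idmorphism A -> B}, forall x, G x = g x.
Proof.
move=> h; pose G : {idmorphism A -> B} := HB.pack (g : A -> B)
  (GRing.RMorphism.class g) (isIDMorphism.Build A B g h).
by exists G.
Qed.

Lemma bijective_of (A B : Type) (g : A -> B) :
  injective g -> (forall y, exists x, g x = y) -> bijective g.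
Proof.
move=> gi /choice[h hK]; exists h => // x; apply: gi; exact: hK.
Qed.

Section VanishingOrder.
Variable L : comNzRingType.
Definition vanishes n (f : pseries L) := forall q, (q < n)%N -> f q = 0.

Lemma vanishesM a b f g : vanishes a f -> vanishes b g -> vanishes (a + b) (f * g).
Proof.
move=> hf hg q qab; rewrite psM big1 // => i _.
case: (ltnP i a) => ia; first by rewrite hf ?mul0r.
by rewrite hg ?mulr0 //; have := ltn_ord i; lia.
Qed.

Lemma vanishes_sum n I (r : seq I) (P : pred I) F :
  (forall i, P i -> vanishes n (F i)) -> vanishes n (\sum_(i <- r | P i) F i).
Proof. by move=> h q qn; rewrite ps_sum big1 // => i Pi; apply: h. Qed.

(** The geometric series of t = 1 - f; the coefficient of degree q only involves
    the powers of [t] of exponent at most q. *)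
Lemma ps_inverse (f : pseries L) : f 0%N = 1 -> exists g, g * f = 1.
Proof.
move=> f0; pose t := 1 - f.
have t0 : vanishes 1 t by move=> [|q] // _; rewrite /t psD [(- f) _]/(- f 0%N) f0 subrr.
have tX n : vanishes n (t ^+ n).
  elim: n => [|n IH]; first by move=> q.
  by rewrite exprS -add1n; apply: vanishesM.
exists (fun q => (\sum_(i < q.+1) t ^+ i) q); apply: funext => q.
transitivity ((f * \sum_(i < q.+1) t ^+ i) q).
  rewrite [f * _]mulrC !psM; apply: eq_bigr => j _; congr (_ * _).
  rewrite !ps_sum (big_ord_widen q.+1 (fun i => (t ^+ i) j)) ?ltn_ord //.
  rewrite big_mkcond; apply: eq_bigr => i _; case: ltnP => // ij.
  by rewrite tX.
have -> : f * \sum_(i < q.+1) t ^+ i = 1 - t ^+ q.+1.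
  by rewrite -[RHS]opprB subrX1 -mulNr; congr (_ * _); rewrite /t; ring.
by rewrite psD -[X in _ + X]/(- ((t ^+ q.+1) q)) tX // oppr0 addr0.
Qed.

Definition ps_coef0 (f : pseries L) : L := f 0%N.
Lemma ps_coef0_zmod : zmod_morphism ps_coef0. Proof. by []. Qed.
Lemma ps_coef0_monoid : monoid_morphism ps_coef0.
Proof. by split=> // f g; rewrite /ps_coef0 psM big_ord1. Qed.
HB.instance Definition _ :=
  GRing.isZmodMorphism.Build (pseries L) L ps_coef0 ps_coef0_zmod.
HB.instance Definition _ :=
  GRing.isMonoidMorphism.Build (pseries L) L ps_coef0 ps_coef0_monoid.

Lemma ps_matrix_inverse n (B : 'M[pseries L]_n) :
  map_mx ps_coef0 B = 1%:M -> exists B', B' *m B = 1%:M.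
Proof.
move=> B0; have [|g hg] := @ps_inverse (\det B).
  by rewrite -[_ 0%N]/(ps_coef0 _) -det_map_mx B0 det1.
by exists (g *: \adj B); rewrite -scalemxAl mul_adj_mx scale_scalar_mx hg.
Qed.

(** Each squaring doubles the order of vanishing of the entries. *)
Lemma ps_idempotent_matrix n (Q : 'M[pseries L]_n) :
  Q *m Q = Q -> map_mx ps_coef0 Q = 0 -> Q = 0.
Proof.
move=> QQ Q0.
have h N i j : vanishes N.+1 (Q i j).
  elim: N i j => [|N IH] i j.
    move=> [|q] // _; have := congr1 (fun B : 'M[L]_n => B i j) Q0.
    by rewrite !mxE.
  rewrite -QQ mxE; apply: vanishes_sum => l _ q qN.
  by apply: (@vanishesM N.+1 N.+1 (Q i l) (Q l j)) => //; lia.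
by apply/matrixP => i j; apply: funext => q; rewrite mxE (h q).
Qed.
End VanishingOrder.

Lemma idempotent_factorization (L : fieldType) k (E : 'M[L]_k) : E *m E = E ->
  exists n (A : 'M[L]_(k, n)) (Y : 'M[L]_(n, k)), A *m Y = E /\ Y *m A = 1%:M.
Proof.
move=> EE; exists (\rank E).
have : row_full (col_base E) by exact: col_base_full.
have : row_free (row_base E) by exact: row_base_free.
have := mulmx_base E; move: (col_base E) (row_base E) => A Y AY.
case/row_freeP=> B' YB /row_fullP[B BA]; exists A, Y; split=> //.
have : A *m Y *m (A *m Y) = A *m Y by rewrite AY EE.
move/(congr1 (fun X => B *m X *m B')) => /=; rewrite !mulmxA BA mul1mx.
by rewrite -!mulmxA YB !mulmx1.
Qed.

Section Existence.
Variables (S : idRingType) (M : idModType S).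
Variables (k : nat) (m : 'I_k -> M) (phi : 'I_k -> M -> S).
Hypothesis phi_functional : forall j, functional (phi j).
Hypothesis dual_basis : forall x, x = \sum_j phi j x *: m j.
Local Notation E := (gram m phi).

Lemma gram_idempotent : E *m E = E.
Proof.
apply/matrixP => i l; rewrite !mxE [X in _ = phi l X]dual_basis.
rewrite (functional_sum _ _ _ (phi_functional l)); apply: eq_bigr => j _.
by rewrite !mxE (phi_functional l).2.
Qed.

(** Over power series the module is solved by Taylor expansion: reducing the
    coordinates of all mtheta q x by [h] gives a horizontal map.  The image of
    [gram] under [h] factors as A0 Y0 with Y0 A0 = 1, and [A0] selects a basis of
    the reduction of [M].  [Y0] is then corrected by an invertible series matrix;
    the defect A Y - gram is idempotent and has zero constant term, so it
    vanishes. *)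
Lemma exists_fundamental_pseries (L : fieldType) (h : {rmorphism S -> L}) :
  exists n (alpha : 'I_n -> M -> pseries L) Y,
    fundamental m phi (taylor h : {idmorphism S -> pseries L}) alpha Y.
Proof.
pose E0 := map_mx h E.
have [|n [A0 [Y0 [AY0 YA0]]]] := @idempotent_factorization L k E0.
  by rewrite -map_mxM gram_idempotent.
pose alpha i x : pseries L := fun q => \sum_j h (phi j (mtheta q x)) * A0 j i.
have aD i x y : alpha i (x + y) = alpha i x + alpha i y.
  apply: funext => q; rewrite psD -big_split; apply: eq_bigr => j _.
  by rewrite mthetaD (phi_functional j).1 rmorphD mulrDl.
have aZ i s x : alpha i (s *: x) = taylor h s * alpha i x.
  apply: funext => q; rewrite psM.
  under [RHS]eq_bigr do rewrite mulr_sumr.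
  rewrite exchange_big; apply: eq_bigr => j _.
  rewrite mthetaZ (functional_sum _ _ _ (phi_functional j)) rmorph_sum mulr_suml.
  by apply: eq_bigr => p _; rewrite (phi_functional j).2 rmorphM mulrA.
have atheta i q x : alpha i (mtheta q x) = theta q (alpha i x).
  apply: funext => p; rewrite ps_thetaE -sumrMnl; apply: eq_bigr => j _.
  rewrite mthetaC -['C(p + q, q)]bin_sub ?leq_addl // addnK.
  rewrite -mulrnAl -rmorphMn; congr (h _ * _).
  by elim: 'C(_, _) => [|N IH]; rewrite ?mulr0n ?(functional0 (phi_functional j)) //
    !mulrS (phi_functional j).1 IH.
pose A := sol_matrix m alpha.
have EA : map_mx (taylor h) E *m A = A.
  apply/matrixP => j i; rewrite !mxE [in RHS](dual_basis (m j)).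
  have a0 : alpha i 0 = 0 by rewrite -(scale0r 0) aZ rmorph0 mul0r.
  rewrite (big_morph (alpha i) (aD i) a0); apply: eq_bigr => l _.
  by rewrite aZ !mxE.
have E0E : map_mx (@ps_coef0 L) (map_mx (taylor h) E) = E0.
  by apply/matrixP => i j; rewrite !mxE; apply: taylor_0.
have A0E : map_mx (@ps_coef0 L) A = A0.
  transitivity (E0 *m A0); last by rewrite -AY0 -mulmxA YA0 mulmx1.
  apply/matrixP => j i; rewrite !mxE; apply: eq_bigr => l _.
  by rewrite !mxE mtheta0.
pose Y1 := map_mx (@ps_const L) Y0.
have Y1E : map_mx (@ps_coef0 L) Y1 = Y0 by apply/matrixP => i j; rewrite !mxE.
have [|B BN] := @ps_matrix_inverse L n (Y1 *m A).
  by rewrite map_mxM Y1E A0E.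
pose Y := B *m Y1 *m map_mx (taylor h) E.
have YA : Y *m A = 1%:M by rewrite /Y -!mulmxA EA.
exists n, alpha, Y; split=> //; rewrite -/A.
have EE : map_mx (taylor h) E *m map_mx (taylor h) E = map_mx (taylor h) E.
  by rewrite -map_mxM gram_idempotent.
have AYE : A *m Y *m map_mx (taylor h) E = A *m Y by rewrite /Y -!mulmxA EE.
have EAY : map_mx (taylor h) E *m (A *m Y) = A *m Y by rewrite mulmxA EA.
have AYAY : A *m Y *m (A *m Y) = A *m Y by rewrite -mulmxA (mulmxA Y) YA mul1mx.
apply/eqP; rewrite eq_sym -subr_eq0; apply/eqP; apply: ps_idempotent_matrix.
  rewrite mulmxBl !mulmxBr EE EAY AYE.
  by rewrite AYAY subrr subr0.
rewrite map_mxB map_mxM E0E A0E.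
have -> : map_mx (@ps_coef0 L) Y = Y0; last by rewrite AY0 subrr.
rewrite /Y map_mxM E0E map_mxM Y1E.
have -> : map_mx (@ps_coef0 L) B = 1%:M.
  have := congr1 (map_mx (@ps_coef0 L)) BN; rewrite map_mxM map_mx1 map_mxM Y1E A0E YA0.
  by rewrite mulmx1.
by rewrite mul1mx -AY0 mulmxA YA0 mul1mx.
Qed.

Lemma fundamental_restrict (R : idRingType) (f : {idmorphism S -> R}) n
    (alpha : 'I_n -> M -> R) Y : fundamental m phi f alpha Y ->
  exists (T : idRingType) (f' : {idmorphism S -> T}) (alpha' : 'I_n -> M -> T) Y',
    fundamental m phi f' alpha' Y' /\ generates (fund_gens m f' alpha' Y').
Proof.
move=> F; pose X := fund_gens m f alpha Y.
pose st := fund_gens_stable dual_basis F.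
pose T : idRingType := id_subring (subring_gen_set X) st.
pose v : {idmorphism T -> R} := @id_subring_val R _ (subring_gen_set X) st.
have vinj : injective v by exact: val_inj.
have vmx a b (B B' : 'M[T]_(a, b)) : map_mx v B = map_mx v B' -> B = B'.
  by move=> /matrixP h; apply/matrixP => i j; apply: vinj; have := h i j; rewrite !mxE.
have Xf s : subring_gen X (f s) by apply: sub_subring_gen; left; exists s.
have XY i j : subring_gen X (Y i j).
  by apply: sub_subring_gen; right; right; exists i, j.
have Xa i x : subring_gen X (alpha i x).
  have hU := subring_gen_set X; case: (hU) => _ _ hM.
  rewrite (fund_coord dual_basis F); apply: (subring_set_sum hU) => j _.
  by apply: hM => //; apply: sub_subring_gen; right; left; exists j, i.
pose f0 s : T := to_subring (subring_gen_set X) (Xf s).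
have vf0 s : v (f0 s) = f s by [].
have f0B : zmod_morphism f0 by move=> x y; apply: vinj; rewrite rmorphB !vf0 rmorphB.
have f0M : monoid_morphism f0.
  by split=> [|x y]; apply: vinj; rewrite ?rmorphM ?rmorph1 !vf0 ?rmorphM ?rmorph1.
have f0T q x : f0 (theta q x) = theta q (f0 x).
  by apply: vinj; rewrite idmorphE !vf0 idmorphE.
pose f' : {idmorphism S -> T} := HB.pack f0
  (GRing.isZmodMorphism.Build S T f0 f0B) (GRing.isMonoidMorphism.Build S T f0 f0M)
  (isIDMorphism.Build S T f0 f0T).
pose alpha' i x : T := to_subring (subring_gen_set X) (Xa i x).
pose Y' : 'M[T]_(n, k) := \matrix_(i, j) to_subring (subring_gen_set X) (XY i j).
have va i x : v (alpha' i x) = alpha i x by [].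
have vA : map_mx v (sol_matrix m alpha') = sol_matrix m alpha.
  by apply/matrixP => j i; rewrite !mxE.
have vY : map_mx v Y' = Y by apply/matrixP => i j; rewrite !mxE.
exists T, f', alpha', Y'; split; first split.
- by move=> i x y; apply: vinj; rewrite rmorphD !va (fundD F).
- by move=> i s x; apply: vinj; rewrite rmorphM !va (fundZ F).
- by move=> i q x; apply: vinj; rewrite idmorphE !va (fund_theta F).
- by apply: vmx; rewrite map_mxM vA vY (fund_YA F) map_mx1.
- apply: vmx; rewrite map_mxM vA vY (fund_AY F).
  by apply/matrixP => j l; rewrite !mxE.
move=> x D hD XD; apply: (gen_ring_generates x) => // z [[s hs]|[[j [i h]]|[i [j h]]]]; apply: XD.
- by left; exists s; apply: vinj.
- by right; left; exists j, i; apply: vinj; rewrite mxE; move: h; rewrite mxE.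
- by right; right; exists i, j; apply: vinj; rewrite mxE.
Qed.

(** The constants of this quotient are under control because it is generated by
    finitely many elements over [S]; the power series ring itself has the whole
    residue field as constants. *)
Lemma exists_simple_fundamental : exists (R : idRingType) (f : {idmorphism S -> R})
    n (alpha : 'I_n -> M -> R) Y,
  [/\ id_simple R, fundamental m phi f alpha Y & generates (fund_gens m f alpha Y)].
Proof.
have [L [h _]] := exists_residue_field (ideal_set_zero S).
have [n [alpha0 [Y0 F0]]] := exists_fundamental_pseries h.
have [T [f1 [alpha1 [Y1 [F1 gen1]]]]] := fundamental_restrict F0.
have [Q [p [sQ psurj]]] := exists_id_simple_quotient T.
pose f : {idmorphism S -> Q} := p \o f1.
exists Q, f, n, (fun i x => p (alpha1 i x)), (map_mx p Y1); split=> //.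
  exact: (fundamental_push (g := p) (f' := f) _ F1).
move=> y D hD XD; have [x <-] := psurj y.
apply: (gen1 x (fun x => D (p x))).
  case: hD => h1 hB hM; split; first by rewrite rmorph1.
    by move=> a b ha hb; rewrite rmorphB; apply: hB.
  by move=> a b ha hb; rewrite rmorphM; apply: hM.
move=> _ [[s <-]|[[j [i <-]]|[i [j <-]]]]; apply: XD.
- by left; exists s.
- by right; left; exists j, i; rewrite !mxE.
- by right; right; exists i, j; rewrite mxE.
Qed.
End Existence.

(** * Constants of the generic solution ring *)

Lemma closed_field_root (K : fieldType) (R : comNzRingType) (j : {rmorphism K -> R})
    (c : R) (q : {poly K}) : GRing.closed_field_axiom K -> is_domain R ->
  q != 0 -> (map_poly j q).[c] = 0 -> exists a, j a = c.
Proof.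
move=> cl dR; have [N] := ubnP (size q); elim: N q => // N IH q sq q0 qc.
have [sq1|sq1] := eqVneq (size q) 1%N.
  have /size_poly1P[a a0 qE] : size q == 1%N by rewrite sq1.
  move/eqP: qc; rewrite qE map_polyC hornerC => /eqP ja.
  by case/eqP: a0; apply: (fmorph_inj j); rewrite rmorph0.
have [a /factor_theorem[q' qE]] := PreClosedField.closed_rootP cl q sq1.
have q'0 : q' != 0 by apply: contraNneq q0 => h; rewrite qE h mul0r.
have := qc; rewrite qE rmorphM hornerM => /dR[|h].
  apply: IH => //; move: sq.
  by rewrite qE size_Mmonic ?monicXsubC // size_XsubC addn2.
exists a; apply/esym/eqP; rewrite -subr_eq0; apply/eqP; rewrite -[RHS]h.
by rewrite rmorphB /= map_polyX map_polyC hornerXsubC.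
Qed.

Section Constants.
Variables (S : idRingType) (sS : id_simple S).
Local Notation C := (field_of (const_ring_field sS)).
Hypothesis C_closed : GRing.closed_field_axiom C.

Definition const_incl : {rmorphism C -> S} := (val : const_ring S -> S).

Lemma const_incl_const c : const_incl c \in constants S.
Proof. exact: (const_valP (c : const_ring S)). Qed.

Lemma const_inclP s : s \in constants S -> exists c, const_incl c = s.
Proof. by move=> h; exists (ConstRing h). Qed.

Lemma idmorph_constant (R R' : idRingType) (f : {idmorphism R -> R'}) c :
  c \in constants R -> f c \in constants R'.
Proof.
move=> /asboolP h; apply/asboolP => q; rewrite -idmorphE h.
by case: q => // q; rewrite rmorph0.
Qed.

Section Transcendental.
Variables (R : idRingType) (sR : id_simple R) (f : {idmorphism S -> R}).
Variable c : R.
Hypothesis c_const : c \in constants R.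
Hypothesis c_new : ~ exists a : C, f (const_incl a) = c.

(** By linear disjointness an algebraic relation over [S] gives one over the
    closed field [C], and a constant algebraic over [C] lies in [C]. *)
Lemma new_constant_transcendental (p : {poly S}) : (map_poly f p).[c] = 0 -> p = 0.
Proof.
move=> pc; apply: contrapT => p0; apply: c_new.
have [|||d [dc [i0 di0] dsum]] := @constants_dependent S sS R f (size p)
    (fun i => c ^+ i) (fun i => p`_i).
- by move=> i; rewrite rpredX.
- by rewrite -[RHS]pc /map_poly horner_poly.
- have lt : ((size p).-1 < size p)%N by rewrite ltn_predL size_poly_gt0; apply/eqP.
  by exists (Ordinal lt); apply/eqP; rewrite -[p`_ _]/(lead_coef p) lead_coef_eq0; apply/eqP.
have [e he] := choice (fun i => const_inclP (dc i)).
pose q : {poly C} := \poly_(j < size p) (if insub j is Some i then e i else 0).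
have qi (i : 'I_(size p)) : q`_i = e i.
  by rewrite coef_poly ltn_ord; case: insubP => [i' _ /val_inj ->|]; rewrite ?ltn_ord.
apply: (@closed_field_root C R (f \o const_incl) c q C_closed (id_simple_domain sR)).
  apply/eqP => q0; apply: di0; rewrite -he -qi q0 coef0; exact: rmorph0.
rewrite (@horner_coef_wide _ (size p)) -?[RHS]dsum; last first.
  by rewrite size_map_poly size_poly.
by apply: eq_bigr => i _; rewrite coef_map qi -he.
Qed.

(** A new constant [c] generates a polynomial ring over [S], over which [R] is
    finitely generated.  Specializing [c] to a general element [g] of [C] therefore
    extends to all of [R]; this kills c - f g, a nonzero constant and so a unit. *)
Lemma new_constant_contradiction (bs : seq R) :
  generates (fun x => (exists s, f s = x) \/ x \in bs) -> False.
Proof.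
move=> gen.
pose A : idomainType := idomain_of (id_simple_domain sS).
pose B : idomainType := idomain_of (id_simple_domain sR).
pose fA : {rmorphism A -> B} := (f : S -> R).
pose j : {rmorphism {poly A} -> B} := horner_eval (c : B) \o map_poly fA.
have jinj : injective j.
  move=> p q /eqP; rewrite -subr_eq0 -rmorphB => /eqP /new_constant_transcendental /eqP.
  by rewrite subr_eq0 => /eqP.
have jC s : j s%:P = f s by rewrite /= /horner_eval map_polyC hornerC.
have [||a a0 ha] := @extension_generated B bs _ j jinj _ 1; last first.
- have [s [us ss]] := closed_infinite C_closed (size a).
  have inj : injective const_incl by exact: val_inj.
  have [g ag] : exists g : C, a.[const_incl g : A] != 0.
    apply: contrapT => hn.
    have : all (root a) (map const_incl s : seq A).
      apply/allP => _ /mapP[g _ ->]; apply/negPn/negP => hg; apply: hn.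
      by exists g.
    move/(max_poly_roots a0); rewrite (map_inj_uniq inj) us size_map ss ltnn.
    by move/(_ isT).
  pose psi : {rmorphism {poly A} -> {fraction A}} :=
    @tofrac A \o horner_eval (const_incl g : A).
  have [||L' [i [psi' [e _ _]]]] := ha {fraction A} psi.
  + exact: (infinite_field_ext (@tofrac A \o (const_incl : {rmorphism C -> A}))
      (closed_infinite C_closed)).
  + by rewrite /psi /= tofrac_eq0.
  have c1 : c - f (const_incl g) \in constants R.
    by rewrite rpredB // idmorph_constant // const_incl_const.
  have [|d _ dc] := id_simple_const_unit sR c1.
    by move=> /eqP; rewrite subr_eq0 => /eqP h; apply: c_new; exists g.
  have : psi' (c - f (const_incl g)) = 0.
    have -> : c - f (const_incl g) = j ('X - (const_incl g : A)%:P).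
      by rewrite rmorphB jC /= /horner_eval map_polyX hornerX.
    by rewrite e /psi /= /horner_eval hornerXsubC subrr tofrac0 rmorph0.
  move=> h; have := congr1 psi' dc; rewrite rmorphM /= h mulr0 rmorph1.
  by move/eqP; rewrite eq_sym oner_eq0.
- exact: oner_neq0.
- move=> x D hD XD; apply: (gen x) => // y [[s <-]|h]; apply: XD; last by right.
  by left; exists s%:P.
Qed.
End Transcendental.

Lemma generated_constants (R : idRingType) (f : {idmorphism S -> R}) (bs : seq R) :
  id_simple R -> generates (fun x => (exists s, f s = x) \/ x \in bs) ->
  forall r, r \in constants R <-> exists2 c, c \in constants S & f c = r.
Proof.
move=> sR gen r; split=> [rc|[c cc <-]]; last exact: idmorph_constant.
apply: contrapT => hn; apply: (new_constant_contradiction sR rc _ gen).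
by move=> [a ha]; apply: hn; exists (const_incl a) => //; apply: const_incl_const.
Qed.
End Constants.

(** * Comparing solution rings *)

(** The subring of [Om] generated by [R] and by constants [La] behaves as the
    tensor product of [R] and [La] over the field [K] of constants of [R]: a
    [K]-algebra map sigma : La -> K extends to it [R]-linearly. *)
Section Specialization.
Variables (R Om : idRingType) (tau : {idmorphism R -> Om}).
Variables (La : comNzRingType) (kappa : {rmorphism La -> Om}).
Variables (K : fieldType) (iK : {rmorphism K -> La}) (cK : {rmorphism K -> R}).
Variable sigma : {rmorphism La -> K}.
Hypothesis sR : id_simple R.
Hypothesis kappa_inj : injective kappa.
Hypothesis kappa_const : forall l, kappa l \in constants Om.
Hypothesis kappaK : forall x, kappa (iK x) = tau (cK x).
Hypothesis constK : forall r, r \in constants R -> exists x, cK x = r.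
Hypothesis sigmaK : forall x, sigma (iK x) = x.

(** By induction on the length of the relation: a nontrivial relation over [R]
    yields one over [K], which [sigma] preserves, and with it one term can be
    eliminated. *)
Lemma specialize_relation n : forall (r : 'I_n -> R) (l : 'I_n -> La),
  \sum_i tau (r i) * kappa (l i) = 0 -> \sum_i r i * cK (sigma (l i)) = 0.
Proof.
elim: n => [|n IH] r l rel; first by rewrite big_ord0.
case: (pselect (exists i, r i <> 0)) => [ex|hn]; last first.
  rewrite big1 // => i _; have -> : r i = 0; last by rewrite mul0r.
  by apply: contrapT => h; apply: hn; exists i.
have [d [dc [i0 di0] dsum]] :=
  constants_dependent sR (fun i => kappa_const (l i)) rel ex.
have [e he] := choice (fun i => constK (dc i)).
have ei0 : e i0 != 0 by apply: contra_notN di0 => /eqP h; rewrite -he h rmorph0.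
pose t i := e i / e i0.
have lsum : \sum_i iK (t i) * l i = 0.
  apply: kappa_inj.
  transitivity (kappa (iK (e i0)^-1) * \sum_i tau (d i) * kappa (l i)).
    rewrite rmorph_sum mulr_sumr; apply: eq_bigr => i _.
    by rewrite -he -kappaK mulrA -!rmorphM /t [e i / _]mulrC.
  by rewrite dsum mulr0 rmorph0.
have ti0 : t i0 = 1 by rewrite /t divff.
have ssum : \sum_i cK (t i) * cK (sigma (l i)) = 0.
  transitivity (cK (sigma (\sum_i iK (t i) * l i))); last by rewrite lsum !rmorph0.
  by rewrite !rmorph_sum; apply: eq_bigr => i _; rewrite -{1}[t i]sigmaK !rmorphM.
have ksum : \sum_i tau (cK (t i)) * kappa (l i) = 0.
  transitivity (kappa (\sum_i iK (t i) * l i)); last by rewrite lsum rmorph0.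
  by rewrite rmorph_sum; apply: eq_bigr => i _; rewrite rmorphM kappaK.
have -> : \sum_i r i * cK (sigma (l i)) =
    \sum_i (r i - r i0 * cK (t i)) * cK (sigma (l i)).
  under [RHS]eq_bigr do rewrite mulrBl -mulrA.
  by rewrite sumrB -mulr_sumr ssum mulr0 subr0.
have : \sum_i tau (r i - r i0 * cK (t i)) * kappa (l i) = 0.
  under eq_bigr do rewrite rmorphB rmorphM /= mulrBl -mulrA.
  by rewrite sumrB -mulr_sumr ksum rel mulr0 subr0.
rewrite !(bigD1_ord i0) //= ti0 rmorph1 mulr1 subrr rmorph0 !mul0r !add0r.
exact: (IH (fun i => r (lift i0 i) - r i0 * cK (t (lift i0 i))) (fun i => l (lift i0 i))).
Qed.
End Specialization.

Section Comparison.
Variables (S : idRingType) (sS : id_simple S) (M : idModType S).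
Local Notation C := (field_of (const_ring_field sS)).
Hypothesis C_closed : GRing.closed_field_axiom C.
Variables (k : nat) (m : 'I_k -> M) (phi : 'I_k -> M -> S).
Hypothesis phi_functional : forall j, functional (phi j).
Hypothesis dual_basis : forall x, x = \sum_j phi j x *: m j.

Lemma generates_seq (R : idRingType) (f : {idmorphism S -> R}) n
    (alpha : 'I_n -> M -> R) Y : generates (fund_gens m f alpha Y) ->
  exists bs : seq R, generates (fun x => (exists s, f s = x) \/ x \in bs).
Proof.
move=> gen; exists ([seq sol_matrix m alpha p.1 p.2 | p <- enum {: 'I_k * 'I_n}]
  ++ [seq Y p.1 p.2 | p <- enum {: 'I_n * 'I_k}]).
move=> x D hD XD; apply: (gen x) => // y [h|[[j [i h]]|[i [j h]]]]; apply: XD.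
- by left.
- right; rewrite mem_cat; apply/orP; left; apply/mapP; exists (j, i) => //.
  by rewrite mem_enum.
- right; rewrite mem_cat; apply/orP; right; apply/mapP; exists (i, j) => //.
  by rewrite mem_enum.
Qed.

(** The ring [R0], being finitely generated over [S], maps to an extension of
    the fraction field of [R1]. *)
Lemma exists_common_field (R0 R1 : idRingType) (f0 : {idmorphism S -> R0})
    (f1 : {idmorphism S -> R1}) (bs : seq R0) :
  id_simple R0 -> id_simple R1 ->
  generates (fun x => (exists s, f0 s = x) \/ x \in bs) ->
  exists (L : fieldType) (h0 : {rmorphism R0 -> L}) (h1 : {rmorphism R1 -> L}),
    forall s, h0 (f0 s) = h1 (f1 s).
Proof.
move=> s0 s1 gen.
pose A := idomain_of (id_simple_domain sS).
pose B0 := idomain_of (id_simple_domain s0); pose B1 := idomain_of (id_simple_domain s1).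
pose j0 : {rmorphism A -> B0} := (f0 : S -> R0).
pose j1 : {rmorphism A -> B1} := (f1 : S -> R1).
have [a a0 ha] := @extension_generated B0 bs A j0 (@idmorphism_inj S sS R0 f0) gen 1 (oner_neq0 _).
pose psi : {rmorphism A -> {fraction B1}} := @tofrac B1 \o j1.
have [||L [i [psi' [e _ _]]]] := ha {fraction B1} psi.
- have Cinf := closed_infinite C_closed.
  exact: (infinite_field_ext (psi \o (const_incl sS : {rmorphism C -> A}))).
- rewrite /psi /= tofrac_eq0; apply: contraNneq a0 => h.
  by apply/eqP; apply: (@idmorphism_inj S sS R1 f1); rewrite rmorph0.
pose h1 : {rmorphism B1 -> L} := i \o @tofrac B1.
by exists L, psi', h1.
Qed.

(** The weak Nullstellensatz: the [C]-algebra generated by [xs] has a point with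
    values in [C]. *)
Lemma exists_specialization (L : fieldType) (iota : {rmorphism C -> L}) (xs : seq L) :
  exists (La : comNzRingType) (v : {rmorphism La -> L}) (iK : {rmorphism C -> La})
    (sigma : {rmorphism La -> C}),
    [/\ injective v, forall x, v (iK x) = iota x, forall x, sigma (iK x) = x &
      forall x, x \in xs -> exists l, v l = x].
Proof.
pose X : set L := fun x => (exists c, iota c = x) \/ x \in xs.
pose La := gen_ring X; pose v : {rmorphism La -> L} := (val : subring _ -> L).
have vinj : injective v by exact: val_inj.
have Xc c : subring_gen X (iota c) by apply: sub_subring_gen; left; exists c.
have Xx x : x \in xs -> subring_gen X x by move=> h; apply: sub_subring_gen; right.
pose i0 c : La := to_subring (subring_gen_set X) (Xc c).
have vi0 c : v (i0 c) = iota c by [].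
have [||iK iKE] := @rmorphism_of C La i0.
- by move=> x y; apply: vinj; rewrite rmorphB !vi0 rmorphB.
- by split=> [|x y]; apply: vinj; rewrite ?rmorphM ?rmorph1 !vi0 ?rmorphM ?rmorph1.
pose B := idomain_of (@subring_domain L _ (subring_gen_set X)).
pose j : {rmorphism C -> B} := (iK : C -> La).
pose bs : seq B := pmap (fun x => if pselect (x \in xs) is left h
  then Some (to_subring (subring_gen_set X) (Xx x h)) else None) xs.
have jinj : injective j by exact: fmorph_inj.
have [|a a0 ha] := @extension_generated B bs C j jinj _ 1 (oner_neq0 _).
  move=> x D hD XD; apply: (gen_ring_generates x) => // y [[c hc]|yx]; apply: XD.
    by left; exists c; apply: vinj; rewrite /j iKE.
  right; rewrite mem_pmap; apply/mapP; exists (val y) => //.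
  case: pselect => // h; congr Some; exact: val_inj.
have [||L' [i [psi [e _ cl]]]] := ha C idfun => //; first exact: closed_infinite.
have [_ [r rK]] := cl C_closed.
exists La, v, iK, (r \o psi); split=> //.
- by move=> x; rewrite iKE vi0.
- by move=> x; rewrite /= e rK.
- by move=> x h; exists (to_subring (subring_gen_set X) (Xx x h)).
Qed.

Section Hom.
Variables (R0 R1 : idRingType) (f0 : {idmorphism S -> R0}) (f1 : {idmorphism S -> R1}).
Variables (n0 : nat) (alpha0 : 'I_n0 -> M -> R0) (Y0 : 'M[R0]_(n0, k)).
Hypothesis F0 : fundamental m phi f0 alpha0 Y0.
Hypothesis gen0 : generates (fund_gens m f0 alpha0 Y0).
Hypothesis s0 : id_simple R0.
Hypothesis sol1 : solution_ring M f1.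

(** Send [R0] and [R1] to a common field [L] and take Taylor expansions.  Over
    power series in [L], the two fundamental matrices differ by a matrix with
    entries in [L], so [R0] lies in the ring generated by [R1] and these entries.
    Specializing the entries to [C] maps this ring onto [R1]. *)
Lemma exists_morphism_to_solution :
  exists g : {idmorphism R0 -> R1}, forall s, g (f0 s) = f1 s.
Proof.
have [s1 const1 triv1] := sol1.
have [n1 [alpha1 [Y1 F1]]] := trivial_fundamental phi_functional dual_basis triv1.
have [bs genbs] := generates_seq gen0.
have [L [h0 [h1 h01]]] := exists_common_field f1 s0 s1 genbs.
pose t0 : {idmorphism R0 -> pseries L} := taylor h0.
pose t1 : {idmorphism R1 -> pseries L} := taylor h1.
pose fO : {idmorphism S -> pseries L} := t0 \o f0.
have t01 s : t1 (f1 s) = fO s.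
  by apply: funext => q; rewrite /= /taylor -!idmorphE h01.
have P0 := fundamental_push (g := t0) (f' := fO) (fun=> erefl) F0.
have P1 := fundamental_push (g := t1) (f' := fO) t01 F1.
have [_ YG Gc] := fundamental_change dual_basis P0 P1.
have [AH _ Hc] := fundamental_change dual_basis P1 P0.
set G := (X in _ = X *m _) in YG Gc; set H := (X in _ = _ *m X) in AH Hc.
pose cK : {rmorphism C -> R1} := f1 \o const_incl sS.
pose gs := [seq G p.1 p.2 0%N | p <- enum {: 'I_n0 * 'I_n1}]
  ++ [seq H p.1 p.2 0%N | p <- enum {: 'I_n1 * 'I_n0}].
have [La [v [iK [sigma [vinj viK sigmaK vgs]]]]] := exists_specialization (h1 \o cK) gs.
pose kap : {rmorphism La -> pseries L} := @ps_const L \o v.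
have kap_const l : kap l \in constants (pseries L) by exact: ps_const_constant.
have kap_inj : injective kap.
  by move=> x y /(congr1 (fun f : pseries L => f 0%N)) /= /vinj.
have kapK x : kap (iK x) = t1 (cK x).
  have xc : cK x \in constants R1.
    by apply/const1; exists (const_incl sS x) => //; apply: const_incl_const.
  by rewrite [RHS](ps_constantE (idmorph_constant t1 xc)) /kap /= viK taylor_0.
have kapG i l : exists g, kap g = G i l.
  have [|g hg] := vgs (G i l 0%N).
    by rewrite mem_cat; apply/orP; left; apply/mapP; exists (i, l) => //; rewrite mem_enum.
  by exists g; rewrite /kap /= hg -ps_constantE.
have kapH i l : exists g, kap g = H i l.
  have [|g hg] := vgs (H i l 0%N).
    by rewrite mem_cat; apply/orP; right; apply/mapP; exists (i, l) => //; rewrite mem_enum.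
  by exists g; rewrite /kap /= hg -ps_constantE.
have constK r : r \in constants R1 -> exists x, cK x = r.
  by move=> /const1[s /(const_inclP sS)[x <-] <-]; exists x.
clearbody kap.
(* Formal sums stand for elements of the tensor product: [ev] is the value in
   power series, [sp] the specialized value in [R1]. *)
pose ev (s : seq (R1 * La)) : pseries L := \sum_(p <- s) t1 p.1 * kap p.2.
pose sp (s : seq (R1 * La)) : R1 := \sum_(p <- s) p.1 * cK (sigma p.2).
have sp0 s : ev s = 0 -> sp s = 0.
  rewrite /ev /sp (big_tnth _ _ s) [X in _ -> X = _](big_tnth _ _ s).
  exact: (specialize_relation s1 kap_inj kap_const kapK constK sigmaK
    (r := fun i => (tnth (in_tuple s) i).1) (l := fun i => (tnth (in_tuple s) i).2)).
pose Rel x y := exists s, t0 x = ev s /\ y = sp s.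
have RelB x y x' y' : Rel x y -> Rel x' y' -> Rel (x - x') (y - y').
  move=> [s [xs ->]] [s' [xs' ->]]; exists (s ++ [seq (- p.1, p.2) | p <- s']).
  rewrite /ev /sp !big_cat !big_map /= rmorphB /= xs xs'; split; congr (_ + _); rewrite -sumrN.
    by apply: eq_bigr => p _; rewrite rmorphN mulNr.
  by apply: eq_bigr => p _; rewrite mulNr.
have RelM x y x' y' : Rel x y -> Rel x' y' -> Rel (x * x') (y * y').
  move=> [s [xs ->]] [s' [xs' ->]].
  exists [seq (p.1 * q.1, p.2 * q.2) | p <- s, q <- s'].
  rewrite rmorphM /= xs xs' /ev /sp !big_distrlr /= !big_allpairs_dep; split.
    by apply: eq_bigr => p _; apply: eq_bigr => q _; rewrite /= !rmorphM /= mulrACA.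
  by apply: eq_bigr => p _; apply: eq_bigr => q _; rewrite /= !rmorphM /= mulrACA.
have Relf s : Rel (f0 s) (f1 s).
  exists [:: (f1 s, 1)]; rewrite /ev /sp !big_seq1 /= !rmorph1 !mulr1.
  by rewrite -[LHS]t01.
have Rel1 : Rel 1 1 by have := Relf 1; rewrite !rmorph1.
have tot x : exists y, Rel x y.
  have tot_sub : subring_set (fun x : R0 => exists y, Rel x y).
    split; first by exists 1.
      by move=> a b [a' ha] [b' hb]; exists (a' - b'); apply: RelB.
    by move=> a b [a' ha] [b' hb]; exists (a' * b'); apply: RelM.
  apply: (gen0 x tot_sub).
  move=> _ [[s <-]|[[j [i <-]]|[i [j <-]]]]; first by exists (f1 s).
    have [w hw] := choice (fun l => kapH l i).
    exists (sp [seq (sol_matrix m alpha1 j l, w l) | l <- enum 'I_n1]).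
    exists [seq (sol_matrix m alpha1 j l, w l) | l <- enum 'I_n1]; split=> //.
    have := congr1 (fun B : 'M_(k, n0) => B j i) AH; rewrite !mxE => ->.
    rewrite /ev big_map big_enum; apply: eq_bigr => l _ /=.
    by rewrite hw !mxE.
  have [w hw] := choice (fun l => kapG i l).
  exists (sp [seq (Y1 l j, w l) | l <- enum 'I_n1]).
  exists [seq (Y1 l j, w l) | l <- enum 'I_n1]; split=> //.
  have := congr1 (fun B : 'M_(n0, k) => B i j) YG; rewrite mxE => ->.
  rewrite mxE /ev big_map big_enum; apply: eq_bigr => l _ /=.
  by rewrite hw [map_mx _ _ _ _]mxE mulrC.
have [|g hg] := rmorph_of_rel tot Rel1 RelB RelM.
  by move=> y [s [xs ->]]; apply: sp0; rewrite -xs rmorph0.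
have gT q x : g (theta q x) = theta q (g x).
  have [s [xs ys]] : Rel x (g x) by apply/hg.
  apply/esym/hg; exists [seq (theta q p.1, p.2) | p <- s].
  rewrite ys idmorphE xs /ev /sp !raddf_sum !big_map /=; split; apply: eq_bigr => p _.
    by rewrite theta_mul_const // idmorphE.
  rewrite theta_mul_const //; apply: (idmorph_constant f1); exact: const_incl_const.
have [g' g'E] := idmorphism_of gT.
by exists g' => s; rewrite g'E; apply/esym/hg.
Qed.

(** For minimality, the fundamental matrices of [R'] and of [R0] differ over
    [R0] by constants, which come from [S]; so the image of [R'] contains the
    generators of [R0]. *)
Lemma generated_picard_vessiot : picard_vessiot M f0.
Proof.
have [bs genbs] := generates_seq gen0.
have c0 := generated_constants C_closed s0 genbs.
split.
  split=> //; exact: (fundamental_trivial dual_basis F0).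
move=> R' f' [s' const' triv'] g gf.
have [n' [alpha' [Y' F']]] := trivial_fundamental phi_functional dual_basis triv'.
have P' := fundamental_push (g := g) (f' := f0) gf F'.
have [_ YG Gc] := fundamental_change dual_basis F0 P'.
have [AH _ Hc] := fundamental_change dual_basis P' F0.
set G := (X in _ = X *m _) in YG Gc; set H := (X in _ = _ *m X) in AH Hc.
apply: bijective_of; first exact: idmorphism_inj.
have im_const r : r \in constants R0 -> exists x, g x = r.
  by move=> /c0[c _ <-]; exists (f' c).
pose Im : set R0 := fun y => exists x, g x = y.
have img : subring_set Im.
  split; first by exists 1; rewrite rmorph1.
    by move=> _ _ [x <-] [y <-]; exists (x - y); rewrite rmorphB.
  by move=> _ _ [x <-] [y <-]; exists (x * y); rewrite rmorphM.
have [_ _ imM] := img.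
move=> y; apply: (gen0 y img).
move=> _ [[s <-]|[[j [i <-]]|[i [j <-]]]]; first by exists (f' s).
  have := congr1 (fun B : 'M_(k, n0) => B j i) AH; rewrite mxE => ->.
  rewrite -/(Im _) mxE; apply: (subring_set_sum img) => l _; apply: imM; last exact: im_const.
  by rewrite mxE; exists (alpha' l (m j)).
have := congr1 (fun B : 'M_(n0, k) => B i j) YG; rewrite mxE => ->.
rewrite -/(Im _); apply: (subring_set_sum img) => l _; apply: imM; first exact: im_const.
by rewrite mxE; exists (Y' l j).
Qed.
End Hom.
End Comparison.

Theorem theorem5p6 (S : idRingType) (M : idModType S)
    (S_simple : id_simple S)
    (C_closed : GRing.closed_field_axiom (const_ring S)) :
  (exists (R : idRingType) (f : {idmorphism S -> R}), picard_vessiot M f) /\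
  (forall (R1 R2 : idRingType)
      (f1 : {idmorphism S -> R1}) (f2 : {idmorphism S -> R2}),
    picard_vessiot M f1 -> picard_vessiot M f2 ->
    exists g : {idmorphism R1 -> R2},
      bijective g /\ (forall s : S, g (f1 s) = f2 s)).
Proof.
have [k [m [phi [hphi dual]]]] := exists_dual_basis S_simple M.
have [R [f [n [alpha [Y [sR F gen]]]]]] := exists_simple_fundamental hphi dual.
have cl : GRing.closed_field_axiom (field_of (const_ring_field S_simple)) := C_closed.
have PV := generated_picard_vessiot cl hphi dual F gen sR.
split; first by exists R, f.
move=> R1 R2 f1 f2 [sol1 min1] [sol2 min2].
have [g1 g1f] := exists_morphism_to_solution cl hphi dual F gen sR sol1.
have [g2 g2f] := exists_morphism_to_solution cl hphi dual F gen sR sol2.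
have [solR _] := PV.
have [h1 h1K Kh1] := min1 R f solR g1 g1f.
have bij2 := min2 R f solR g2 g2f.
have h1B : zmod_morphism h1.
  by move=> x y; apply: (can_inj h1K); rewrite rmorphB /= !Kh1.
have h1M : monoid_morphism h1.
  by split=> [|x y]; apply: (can_inj h1K); rewrite ?rmorphM ?rmorph1 /= !Kh1.
have [h hE] := rmorphism_of h1B h1M.
have [|h' h'E] := @idmorphism_of R1 R h.
  by move=> q x; rewrite !hE; apply: (can_inj h1K); rewrite idmorphE !Kh1.
exists (g2 \o h'); split.
  by apply: bij_comp => //; exists g1 => x; rewrite h'E hE.
by move=> s; rewrite /= h'E hE -g1f h1K g2f.
Qed.
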